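(* Let $\beta_j=M^{k+1-j}$ for $1\le j\le k$ and $\beta_j=0$ for $k+1\le j\le p$, where $k/p\to\epsilon$ with $0<\epsilon<1$. If $M$ is sufficiently large, precisely, if $M=M_n$ satisfies $M\ge n^a$ as $n\to\infty$ for any constant $a>\frac12$, then there exists $\lambda$ depending on $n$ such that $$\#\left\{j:\widehat\beta_j(\lambda)\ne0,\ \beta_j\ne0\right\}=(1+o_{\mathbb P}(1))\frac{n}{2\log p}\quad\text{and}\quad\#\left\{j:\widehat\beta_j(\lambda)\ne0,\ \beta_j=0\right\}=0$$ as $n,p\to\infty$, the second equality holding with probability tending to one.
   Context: Model. $\boldsymbol y=\boldsymbol X\boldsymbol\beta+\boldsymbol z$ with $\boldsymbol X\in\mathbb R^{n\times p}$. Along a sequence of problems, $n,p\to\infty$ with $n/p\to\delta$ for a constant $\delta>0$; $\boldsymbol X$ has i.i.d. $\mathcal N(0,1/n)$ entries; $\boldsymbol z$ has i.i.d. $\mathcal N(0,\sigma^2)$ entries with $\sigma\ge0$ fixed; $\boldsymbol X$ and $\boldsymbol z$ are independent; $\boldsymbol\beta$ is deterministic. The Lasso estimate is, for $\lambda>0$, $\widehat{\boldsymbol\beta}(\lambda)=\arg\min_{\boldsymbol b\in\mathbb R^p}\frac12\|\boldsymbol y-\boldsymbol X\boldsymbol b\|^2+\lambda\|\boldsymbol b\|_1$. The notation $o_{\mathbb P}(1)$ denotes a quantity tending to $0$ in probability. *)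

(* Defs.v *)
From HB Require Import structures.
From mathcomp Require Import all_boot all_order all_algebra.
From mathcomp Require Import all_classical all_reals all_analysis.
Set Implicit Arguments.
Unset Strict Implicit.
Unset Printing Implicit Defensive.
Import Order.TTheory GRing.Theory Num.Theory.
Import numFieldNormedType.Exports.
Local Open Scope classical_set_scope.
Local Open Scope ring_scope.

(* N(m, v), parametrized by the variance v >= 0. The case v = 0 is treated
   separately because [normal_prob m 0] is the uniform law on [0, 1] rather
   than the Dirac mass at m. *)
Definition gaussian {R : realType} (m v : R) (A : set R) : \bar R :=
  if v == 0 then \d_m A else normal_prob m (Num.sqrt v) A.

Definition has_gaussian_law {R : realType} (d : measure_display)
    (T : measurableType d) (P : probability T R) (m v : R)
    (Z : {RV P >-> R}) : Prop :=
  forall A : set R, measurable A -> distribution P Z A = gaussian m v A.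

Definition mutually_independent {R : realType} (d : measure_display)
    (T : measurableType d) (P : probability T R) (I : finType)
    (Z : I -> {RV P >-> R}) : Prop :=
  forall (J : {set I}) (A : I -> set R), (forall i, measurable (A i)) ->
    P (\bigcap_(i in [set` J]) (Z i @^-1` A i)) =
    (\prod_(i in J) P (Z i @^-1` A i))%E.

Definition sigma_generated {R : realType} (d : measure_display)
    (T : measurableType d) (P : probability T R) (I : finType)
    (Z : I -> {RV P >-> R}) : set (set T) :=
  <<s [set E | exists i : I, exists2 A : set R,
                 measurable A & E = Z i @^-1` A] >>.

Definition independent_families {R : realType} (d : measure_display)
    (T : measurableType d) (P : probability T R) (I J : finType)
    (Z : I -> {RV P >-> R}) (W : J -> {RV P >-> R}) : Prop :=
  forall E F : set T, sigma_generated Z E -> sigma_generated W F ->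
    P (E `&` F) = (P E * P F)%E.

Definition iid_gaussian {R : realType} (d : measure_display)
    (T : measurableType d) (P : probability T R) (I : finType) (m v : R)
    (Z : I -> {RV P >-> R}) : Prop :=
  mutually_independent Z /\ forall i, has_gaussian_law m v (Z i).

Definition lasso_objective {R : realType} (n p : nat) (X : 'M[R]_(n, p))
    (y : 'cV[R]_n) (lambda : R) (b : 'cV[R]_p) : R :=
  2^-1 * (\sum_i (y - X *m b) i 0 ^+ 2) + lambda * (\sum_j `|b j 0|).

Definition is_lasso_estimate {R : realType} (n p : nat) (X : 'M[R]_(n, p))
    (y : 'cV[R]_n) (lambda : R) (b : 'cV[R]_p) : Prop :=
  forall b' : 'cV[R]_p,
    lasso_objective X y lambda b <= lasso_objective X y lambda b'.

(* Indices start at 0: the 1-based coordinate is j + 1, so that the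
   exponent k + 1 - (j + 1) is k - j. *)
Definition beta_coef {R : realType} (p k : nat) (M : R) : 'cV[R]_p :=
  \col_j (if (j < k)%N then M ^+ (k - j) else 0).

Definition true_selections {R : realType} (p : nat) (beta b : 'cV[R]_p) : nat :=
  #|[pred j : 'I_p | (b j 0 != 0) && (beta j 0 != 0)]|.

Definition false_selections {R : realType} (p : nat)
    (beta b : 'cV[R]_p) : nat :=
  #|[pred j : 'I_p | (b j 0 != 0) && (beta j 0 == 0)]|.

(* Z l = o_P(1) as l -> oo; each Z l may live on its own probability space. *)
Definition is_oP1 {R : realType} (d : nat -> measure_display)
    (T : forall l, measurableType (d l)) (P : forall l, probability (T l) R)
    (Z : forall l, T l -> R) : Prop :=
  forall e : R, 0 < e ->
    (fun l => P l [set w | e <= `|Z l w|]) @ \oo --> 0%E.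
Arguments is_oP1 {R d T} P Z.

(* Main.v *)
Require Import Defs.
From HB Require Import structures.
From mathcomp Require Import all_boot all_order all_algebra.
From mathcomp Require Import all_classical all_reals all_analysis.
From mathcomp Require Import measurable_realfun measurable_fun_approximation.
From mathcomp Require Import ring lra zify.
Set Implicit Arguments.
Unset Strict Implicit.
Unset Printing Implicit Defensive.
Import Order.TTheory GRing.Theory Num.Theory.
Import numFieldNormedType.Exports.
Local Open Scope classical_set_scope.
Local Open Scope ring_scope.

(** Write $L = \log p$ and let $S$ be the set of the first $m$ columns, with $m$
slightly below $n / (2 L)$. The claim holds because, for
$\lambda = 19 L M^{k-m} / e$ with a small $e$, the Lasso solution has support
exactly $S$ with probability close to $1$.

The scale separation $M \ge n^a$ makes this possible. The part of the signal
outside $S$ and the noise form a residual $r$ whose correlations with the columns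
are at most $18 L M^{k-m} < e \lambda$, while the coefficients on
$S$ are at least $M \cdot M^{k-m}$, and the shrinkage of the Lasso on $S$ is at
most $\lambda \sqrt m$ up to a constant; $\lambda \sqrt m$ is below
$M \cdot M^{k-m}$ because $L \sqrt n = o(n^a)$ for $a > 1/2$.

So the candidate is the least squares fit on $S$, shifted by $-\lambda G^{-1} 1$,
where $G = X_S^T X_S$. Its residual is the projection of $r$ orthogonally to the
columns of $S$, plus $\lambda u$ with $u = X_S G^{-1} 1$. By the optimality
conditions ([lasso_strict_dual_unique], [lasso_selects_exactly]) this candidate
is the only minimizer as soon as $|X_j^T u| < 1$ with some margin for every $j$
outside $S$. Only this condition is sharp. Given $X_S$, the variable $X_j^T u$ is
centered Gaussian with variance $\|u\|^2 / n = 1^T G^{-1} 1 / n$, about $m / n$;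
the maximum over the $p - m$ columns is about $\sqrt{2 L m / n}$, which is below
$1$ exactly when $m < n / (2 L)$.

The probabilistic inputs all come from the moment generating function of a
Gaussian variable, by exponential Markov inequalities.
- [decoupling] makes sense of the words given $X_S$ without conditional laws: a
  function of two disjoint subfamilies of independent variables may be integrated
  with two independent copies of the sample point. It gives [cross_tail] for
  $X_j^T u$, and the product rule [expect_blocks_mul].
- [gram_lower_bound] bounds the smallest singular value of $X_S$ from below by
  almost $1$, which controls $\|u\|^2$ and $\|G^{-1} 1\|^2$. For a fixed vector this is
  the lower tail of a chi-square law ([gaussian_image_lower_tail]). It is extended
  to all vectors by rounding to a lattice; the number of lattice points is
  exponential in $m = o(n)$, so a union bound suffices. The direction of each
  rounding is chosen so that only the Frobenius norm of $X_S$ enters the error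
  ([round_to_grid], [net_lower_bound]).
- [max_entry_tail] bounds all the entries of $X$ and of the noise.

These are assembled for a single problem in [support_recovery], and
[near_parameters] checks that every error term is eventually small. This gives,
for each fixed accuracy, a penalty that works eventually; one sequence of
penalties that works for all accuracies is a diagonal sequence
([diagonal_parameter]). *)

(** * Level sets and integrals of real-valued functions *)

Section RealLevelSets.
Context {R : realType} {d : measure_display} {T : measurableType d}.
Implicit Types f g : T -> R.

Lemma measurable_set_lt f g : measurable_fun setT f -> measurable_fun setT g ->
  measurable [set w | f w < g w].
Proof.
move=> /measurable_EFinP mf /measurable_EFinP mg.
have := measurable_lte measurableT mf mg; rewrite setTI.
by under eq_set do rewrite lte_fin.
Qed.

Lemma measurable_set_le f g : measurable_fun setT f -> measurable_fun setT g ->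
  measurable [set w | f w <= g w].
Proof.
move=> mf mg; have -> : [set w | f w <= g w] = ~` [set w | g w < f w].
  by apply/seteqP; split=> w /=; [move/le_gtF => ->|move/negP; rewrite -leNgt].
exact/measurableC/measurable_set_lt.
Qed.

Lemma prob_le_integral (P : probability T R) (A : set T) g :
  measurable A -> measurable_fun setT g -> (forall w, 0 <= g w) ->
  (forall w, A w -> 1 <= g w) -> (P A <= \int[P]_w (g w)%:E)%E.
Proof.
move=> mA mg g0 g1; rewrite -[P A]mul1e -integral_cst// integral_mkcond.
apply: ge0_le_integral => //=.
- by move=> w _; rewrite /patch; case: ifP.
- by apply/measurable_restrict; rewrite ?setIT//.
- exact/measurable_EFinP.
by move=> w _; rewrite /patch; case: ifPn => [/set_mem/g1|_]; rewrite ?lee_fin.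
Qed.

Lemma integral_cstR (P : probability T R) (c : R) : (\int[P]_w c%:E = c%:E)%E.
Proof.
rewrite -[RHS]mule1 -(probability_setT P); exact: integral_cst.
Qed.

Lemma ge0_integral_addR (P : probability T R) f g :
  measurable_fun setT f -> measurable_fun setT g ->
  (forall w, 0 <= f w) -> (forall w, 0 <= g w) ->
  (\int[P]_w (f w + g w)%:E = (\int[P]_w (f w)%:E) + \int[P]_w (g w)%:E)%E.
Proof.
move=> mf mg f0 g0; under eq_integral do rewrite EFinD.
by rewrite ge0_integralD//; first [exact/measurable_EFinP|move=> w _; rewrite lee_fin].
Qed.

Lemma ge0_integral_scaleR (P : probability T R) (c : R) f :
  measurable_fun setT f -> 0 <= c -> (forall w, 0 <= f w) ->
  (\int[P]_w (c * f w)%:E = c%:E * \int[P]_w (f w)%:E)%E.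
Proof.
move=> mf c0 f0; under eq_integral do rewrite EFinM.
by rewrite ge0_integralZl//; first [exact/measurable_EFinP|move=> w _; rewrite lee_fin].
Qed.

Lemma le_integralR (P : probability T R) f g :
  measurable_fun setT f -> measurable_fun setT g ->
  (forall w, 0 <= f w) -> (forall w, f w <= g w) ->
  (\int[P]_w (f w)%:E <= \int[P]_w (g w)%:E)%E.
Proof.
move=> mf mg f0 fg; apply: ge0_le_integral => //;
  by first [exact/measurable_EFinP|move=> w _; rewrite lee_fin].
Qed.

Lemma measurable_expR_scale (c : R) f : measurable_fun setT f ->
  measurable_fun setT (fun w => expR (c * f w)).
Proof.
by move=> mf; apply: measurableT_comp => //; exact: measurable_funM.
Qed.

End RealLevelSets.


(** * Independence of the sigma-algebras of disjoint subfamilies *)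

Section Independence.
Context {R : realType} {d : measure_display} {T : measurableType d}.
Variable (P : probability T R).

(** Independence of a fixed event from a pi-system extends to the generated
sigma-algebra: $E \mapsto P(E \cap F)$ and $E \mapsto P(F) P(E)$ are finite measures
that agree on the pi-system. *)
Lemma indep_sigma_ext (G : set (set T)) (F : set T) :
  G `<=` measurable -> setI_closed G -> G setT -> measurable F ->
  (forall E, G E -> P (E `&` F) = (P E * P F)%E) ->
  forall E, <<s G >> E -> P (E `&` F) = (P E * P F)%E.
Proof.
move=> Gm GI GT mF GF.
have PFfin : P F \is a fin_num by exact: fin_num_measure.
pose r : {nonneg R} := NngNum (fine_ge0 (measure_ge0 P F)).
have rE A : mscale r P A = (P A * P F)%E by rewrite /mscale/= muleC /r/= fineK.
move=> E sE; rewrite -rE.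
apply: (@g_sigma_algebra_measure_unique _ R T G Gm (fun=> setT) _ _
  (mrestr P mF) (mscale r P)) => //.
- by rewrite bigcup_const//; exists 0%N.
- by move=> A GA; rewrite [RHS]rE; exact: GF.
- by move=> _; rewrite /= /mrestr setTI -ge0_fin_numE.
Qed.

Section families.
Variables (I : finType) (Z : I -> {RV P >-> R}).
Hypothesis Zind : mutually_independent Z.

(** Finite intersections are taken over all of [J], with [setT] allowed as a
constraint, so that the cylinders form a pi-system that contains the whole space. *)
Definition cylinders (J : {set I}) : set (set T) :=
  [set E | exists2 A : I -> set R, (forall i, measurable (A i)) &
             E = \bigcap_(i in [set` J]) (Z i @^-1` A i)].

Lemma cylinders_measurable J : cylinders J `<=` measurable.
Proof.
move=> _ [A mA ->]; apply: fin_bigcap_measurable; first exact: finite_finset.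
by move=> i _; rewrite -[X in measurable X]setTI; exact: measurable_funP.
Qed.

Lemma cylindersT J : cylinders J setT.
Proof.
exists (fun=> setT) => //; apply/seteqP; split=> // w _ i _; exact: I.
Qed.

Lemma cylindersI J : setI_closed (cylinders J).
Proof.
move=> _ _ [A mA ->] [B mB ->]; exists (fun i => A i `&` B i).
  by move=> i; exact: measurableI.
apply/seteqP; split=> [w [hA hB] i Ji|w hw]; first by split; [exact: hA|exact: hB].
by split=> i Ji; have [] := hw i Ji.
Qed.

(** The sample space with the sigma-algebra of the subfamily indexed by [J]; it has
the same points as [T], so that a function on [T] can be said to depend on this
subfamily only. *)
Definition sub_space (J : {set I}) : measurableType _ :=
  g_sigma_algebraType (cylinders J).

Lemma sub_space_measurable J (E : set T) :
  (measurable (E : set (sub_space J))) -> measurable E.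
Proof. by apply: smallest_sub; [exact: sigma_algebra_measurable|exact: cylinders_measurable]. Qed.

Lemma indep_cylinders (J K : {set I}) : [disjoint J & K]%B ->
  forall E F, cylinders J E -> cylinders K F -> P (E `&` F) = (P E * P F)%E.
Proof.
move=> dJK _ _ [A mA ->] [B mB ->].
pose C i := if i \in J then A i else B i.
have mC i : measurable (C i) by rewrite /C; case: ifP.
have KJ i : i \in K -> (i \in J) = false.
  by move=> iK; apply/negbTE; rewrite (disjointFl dJK iK).
have -> : \bigcap_(i in [set` J]) (Z i @^-1` A i) `&`
    \bigcap_(i in [set` K]) (Z i @^-1` B i) =
    \bigcap_(i in [set` finset.setU J K]) (Z i @^-1` C i).
  apply/seteqP; split=> [w [hA hB] i /=|w hw].
    by rewrite /C finset.in_setU; case: ifPn => /= iJ; [move=> _; exact: hA|exact: hB].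
  split=> i /= iJ.
    by have := hw i; rewrite /= finset.in_setU /C iJ; apply.
  by have := hw i; rewrite /= finset.in_setU /C KJ// iJ; apply.
rewrite !Zind// (eq_bigl (mem [predU J & K])); last first.
  by move=> i; rewrite /= finset.in_setU.
rewrite bigU//=; congr (_ * _)%E; apply: eq_bigr => i iJ.
  by rewrite /C iJ.
by rewrite /C KJ.
Qed.

Lemma indep_sub_space (J K : {set I}) : [disjoint J & K]%B ->
  forall (E : set (sub_space J)) (F : set (sub_space K)),
  measurable E -> measurable F -> P ((E : set T) `&` F) = (P E * P F)%E.
Proof.
move=> dJK E F mE mF.
apply: (indep_sigma_ext (G := cylinders J)) => //; last first.
  move=> {mE}E EJ; rewrite setIC muleC.
  apply: (indep_sigma_ext (G := cylinders K)) => //.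
  - exact: cylinders_measurable.
  - exact: cylindersI.
  - exact: cylindersT.
  - by apply: cylinders_measurable EJ.
  - by move=> {mF}F FK; rewrite setIC muleC (indep_cylinders dJK).
- exact: sub_space_measurable mF.
- exact: cylindersT.
- exact: cylindersI.
- exact: cylinders_measurable.
Qed.

Lemma measurable_sub_space (J : {set I}) i : i \in J ->
  measurable_fun setT (Z i : sub_space J -> R).
Proof.
move=> iJ _ A mA; rewrite setTI; apply: sub_gen_smallest.
exists (fun j => if j == i then A else setT).
  by move=> j; case: ifP.
apply/seteqP; split=> [w wA j _ /=|w /(_ i iJ)/=]; first by case: eqP => // ->.
by rewrite eqxx.
Qed.

Lemma measurable_sub_id (J : {set I}) : measurable_fun setT (idfun : T -> sub_space J).
Proof. by move=> _ A mA; rewrite setTI; exact: sub_space_measurable mA. Qed.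

Lemma measurable_sub_sub (J K : {set I}) : J \subset K ->
  measurable_fun setT (idfun : sub_space K -> sub_space J).
Proof.
move=> /fintype.subsetP JK _ A mA; rewrite setTI preimage_id.
move: A mA; apply: smallest_sub; first exact: sigma_algebra_measurable.
move=> _ [A mA ->]; apply: fin_bigcap_measurable; first exact: finite_finset.
move=> i /= iJ; rewrite -[X in measurable X]setTI; apply: (@measurable_sub_space K) => //.
exact: JK.
Qed.

End families.
End Independence.

Section Decoupling.
Context {R : realType} {d : measure_display} {T : measurableType d}.
Variable (P : probability T R).
Variables (I : finType) (Z : I -> {RV P >-> R}).
Hypothesis Zind : mutually_independent Z.

(** The diagonal map from [T] to the product of the two sub-sigma-algebras sends [P]
to a measure that agrees with the product of the restrictions of [P] on
rectangles, by independence; hence it is the product measure, and Tonelli applies.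
This replaces conditioning on one of the two subfamilies. *)
Lemma decoupling (J K : {set I}) (phi : sub_space Z J * sub_space Z K -> \bar R) :
  [disjoint J & K]%B -> measurable_fun setT phi -> (forall z, (0 <= phi z)%E) ->
  (\int[P]_w phi (w, w) = \int[P]_w1 \int[P]_w2 phi (w1, w2))%E.
Proof.
move=> dJK mphi phi0.
pose iJ : {mfun T >-> sub_space Z J} := mfun_Sub (mem_set (@measurable_sub_id R d T P I Z J)).
pose iK : {mfun T >-> sub_space Z K} := mfun_Sub (mem_set (@measurable_sub_id R d T P I Z K)).
have mdiag : measurable_fun setT (fun w : T => (w : sub_space Z J, w : sub_space Z K)).
  apply: measurable_fun_pair; exact: measurable_sub_id.
pose dg : {mfun T >-> (sub_space Z J * sub_space Z K)%type} := mfun_Sub (mem_set mdiag).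
have DE : forall X, measurable X ->
    (distribution P iJ \x distribution P iK)%E X = distribution P dg X.
  apply: product_measure_unique => A B mA mB.
  exact: (indep_sub_space Zind dJK).
transitivity (\int[distribution P dg]_z phi z)%E.
  by rewrite ge0_integral_distribution.
transitivity (\int[(distribution P iJ \x distribution P iK)%E]_z phi z)%E.
  by apply: eq_measure_integral => A mA _; rewrite /= -DE.
rewrite fubini_tonelli1// ge0_integral_distribution//.
- apply: eq_integral => w1 _ /=; rewrite /fubini_F ge0_integral_distribution//.
  exact: measurableT_comp.
- exact: measurable_fun_fubini_tonelli_F.
- by move=> y; apply: integral_ge0.
Qed.

Lemma measurable_decoupled (J K : {set I}) (phi : sub_space Z J * sub_space Z K -> \bar R) :
  measurable_fun setT phi -> (forall z, (0 <= phi z)%E) ->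
  measurable_fun setT (fun w1 : T => (\int[P]_w2 phi (w1, w2))%E).
Proof.
move=> mphi phi0.
pose iK : {mfun T >-> sub_space Z K} :=
  mfun_Sub (mem_set (@measurable_sub_id R d T P I Z K)).
have -> : (fun w1 : T => (\int[P]_w2 phi (w1, w2))%E) =
    fubini_F (distribution P iK) phi.
  apply/funext => w1; rewrite /fubini_F ge0_integral_distribution//.
  exact: measurableT_comp.
have mF := measurable_fun_fubini_tonelli_F (m2 := distribution P iK) phi mphi phi0.
exact: (measurableT_comp mF (@measurable_sub_id R d T P I Z J)).
Qed.

(** A bound that holds when the variables of [J] are frozen also holds without
freezing them. *)
Lemma decoupling_prob_le (J K : {set I}) (S : set (sub_space Z J * sub_space Z K)) q :
  [disjoint J & K]%B -> measurable S ->
  (forall w1, P [set w2 | S (w1, w2)] <= q)%E ->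
  (P [set w | S (w, w)] <= q)%E.
Proof.
move=> dJK mS Sq.
pose phi (z : sub_space Z J * sub_space Z K) := (\1_S z : R)%:E.
have mphi : measurable_fun setT phi by apply/measurable_EFinP; exact: measurable_indic.
have phi0 z : (0 <= phi z)%E by rewrite lee_fin.
have := decoupling dJK mphi phi0.
have intE (A : set T) (f : T -> \bar R) : measurable A ->
    (forall w, f w = (\1_A w)%:E) -> (\int[P]_w f w)%E = P A.
  move=> mA fE; rewrite (eq_integral (fun w => (\1_A w)%:E)) => [|w _]; last exact: fE.
  by rewrite integral_indic ?setIT.
have mw1 (w1 : sub_space Z J) : measurable [set w2 : T | S (w1, w2)].
  apply: (@sub_space_measurable _ _ _ _ _ Z K).
  by have := @pair1_measurable _ _ (sub_space Z J) (sub_space Z K) w1 measurableT S mS;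
    rewrite setTI.
have mw : measurable [set w : T | S (w, w)].
  rewrite -[X in measurable X]setTI.
  have mdiag : measurable_fun setT (fun w : T => (w : sub_space Z J, w : sub_space Z K)).
    by apply: measurable_fun_pair; exact: measurable_sub_id.
  exact: (mdiag measurableT S mS).
rewrite (intE [set w | S (w, w)]) // => ->.
apply: (@le_trans _ _ (\int[P]_w (cst q w))%E).
  apply: ge0_le_integral => //=.
  - by move=> w1 _; exact: integral_ge0.
  - exact: measurable_decoupled.
  by move=> w1 _; rewrite (intE [set w2 | S (w1, w2)]).
rewrite integral_cst// [X in (q * X)%E](_ : _ = 1%E) ?mule1//.
exact: probability_setT.
Qed.

Lemma expect_indep_mul (J K : {set I}) (f g : T -> R) :
  [disjoint J & K]%B ->
  measurable_fun setT (f : sub_space Z J -> R) ->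
  measurable_fun setT (g : sub_space Z K -> R) ->
  (forall w, 0 <= f w) -> (forall w, 0 <= g w) ->
  (\int[P]_w (f w * g w)%:E = (\int[P]_w (f w)%:E) * \int[P]_w (g w)%:E)%E.
Proof.
move=> dJK mf mg f0 g0.
have mgT : measurable_fun setT g.
  by apply: (measurableT_comp mg); exact: measurable_sub_id.
have mfT : measurable_fun setT f.
  by apply: (measurableT_comp mf); exact: measurable_sub_id.
have intg0 : (0 <= \int[P]_w (g w)%:E)%E.
  by apply: integral_ge0 => w _; rewrite lee_fin.
rewrite (decoupling (phi := fun z => (f z.1 * g z.2)%:E) dJK).
- under eq_integral => w1 _ do rewrite (eq_integral (fun w2 => ((f w1)%:E * (g w2)%:E)%E))//.
  transitivity (\int[P]_w1 ((f w1)%:E * \int[P]_w2 (g w2)%:E))%E.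
    apply: eq_integral => w1 _; rewrite ge0_integralZl//.
    - by apply/measurable_EFinP.
    - by move=> w _; rewrite lee_fin.
    - by rewrite lee_fin.
  rewrite ge0_integralZr//.
  - by apply/measurable_EFinP.
  - by move=> w _; rewrite lee_fin.
- apply/measurable_EFinP; apply: measurable_funM.
    exact: (measurableT_comp mf).
  exact: (measurableT_comp mg).
- by move=> z; rewrite lee_fin mulr_ge0.
Qed.

(** Induction on the list of blocks: the product over the tail is measurable with
respect to the union of its blocks, which is disjoint from the first block. *)
Lemma expect_blocks_mul (A : eqType) (s : seq A) (B : A -> {set I}) (f : A -> T -> R) :
  uniq s -> (forall a b, a \in s -> b \in s -> a != b -> [disjoint B a & B b]%B) ->
  (forall a, a \in s -> measurable_fun setT (f a : sub_space Z (B a) -> R)) ->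
  (forall a w, 0 <= f a w) ->
  (\int[P]_w (\prod_(a <- s) f a w)%:E = \prod_(a <- s) \int[P]_w (f a w)%:E)%E.
Proof.
move=> + + + f0; elim: s => [|a s IH] /=.
  move=> _ _ _; under eq_integral do rewrite big_nil.
  rewrite big_nil integral_cst// mul1e; exact: probability_setT.
move=> /andP[as_ us] dis mf.
pose K := [set i | has (fun b => i \in B b) s]%SET.
under eq_integral do rewrite big_cons.
rewrite big_cons (expect_indep_mul (J := B a) (K := K)) => [|||||w]//.
- congr (_ * _)%E; apply: IH => //.
    by move=> b c bs cs; apply: dis; rewrite inE ?bs ?cs orbT.
  by move=> b bs; apply: mf; rewrite inE bs orbT.
- rewrite disjoint_subset; apply/fintype.subsetP => i iB; rewrite !inE.
  apply/negP => /hasP[b bs ib]; have /negP := as_; apply.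
  have [ab|ab] := eqVneq a b; first by rewrite ab.
  have := dis a b (mem_head _ _) _ ab; rewrite inE bs orbT => /(_ isT) D.
  by rewrite (disjointFr D iB) in ib.
- by apply: mf; exact: mem_head.
- apply: measurable_prod => b bs.
  have mb := mf b; rewrite inE bs orbT in mb.
  apply: (measurableT_comp (mb isT)); apply: measurable_sub_sub.
  by apply/fintype.subsetP => i ib; rewrite inE; apply/hasP; exists b.
- by apply: prodr_ge0 => b _.
Qed.

End Decoupling.

(** * Moment generating functions of Gaussian variables *)

Section GaussianMgf.
Context {R : realType}.

(** The Gaussian law is defined by its density, and the density is almost everywhere
the Radon-Nikodym derivative, so that the change of variables for the latter
applies. *)
Lemma integral_normal_prob_ge0 (m s : R) (f : R -> \bar R) :
  measurable_fun setT f -> (forall x, (0 <= f x)%E) ->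
  (\int[normal_prob m s]_x f x =
   \int[lebesgue_measure]_x (f x * (normal_pdf m s x)%:E))%E.
Proof.
move=> mf f0; have dom := normal_prob_dominates m s.
have mpdf : measurable_fun setT (fun x => (normal_pdf m s x)%:E).
  by apply/measurable_EFinP; exact: measurable_normal_pdf.
rewrite -(Radon_Nikodym_SigmaFinite.change_of_variables dom)//.
have mRN := measurable_int _ (Radon_Nikodym_SigmaFinite.f_integrable dom).
apply: ae_eq_integral => //; [exact: emeasurable_funM|exact: emeasurable_funM|].
apply: ae_eqe_mul2l; apply: integral_ae_eq => //.
- exact: Radon_Nikodym_SigmaFinite.f_integrable.
- by move=> E _ mE; rewrite -Radon_Nikodym_SigmaFinite.f_integral.
Qed.

(** Completing the square: tilting a centered Gaussian density by an exponential
shifts its mean and multiplies it by the moment generating function. *)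
Lemma normal_pdf_tilt (s t x : R) : s != 0 ->
  expR (t * x) * normal_pdf 0 s x =
  expR (t ^+ 2 * s ^+ 2 / 2) * normal_pdf (t * s ^+ 2) s x.
Proof.
move=> s0; rewrite !normal_pdfE// mulrCA [RHS]mulrCA; congr (_ * _).
rewrite /normal_fun -!expRD; congr expR.
have s20 : s ^+ 2 != 0 by rewrite expf_neq0.
by field.
Qed.

Lemma normal_prob_mgf (s t : R) : s != 0 ->
  (\int[normal_prob 0%R s]_x (expR (t * x))%:E = (expR (t ^+ 2 * s ^+ 2 / 2))%:E)%E.
Proof.
move=> s0; rewrite integral_normal_prob_ge0//; last first.
  apply/measurable_EFinP; apply: measurableT_comp => //.
under eq_integral => x _ do rewrite -EFinM normal_pdf_tilt// EFinM.
rewrite ge0_integralZl//.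
- by rewrite integral_normal_pdf mule1.
- by apply/measurable_EFinP; exact: measurable_normal_pdf.
- by move=> x _; rewrite lee_fin normal_pdf_ge0.
Qed.

End GaussianMgf.

Section Mgf.
Context {R : realType} {d : measure_display} {T : measurableType d}.
Variable (P : probability T R).

(** The only property of the Gaussian law that is used: it is stable under linear
combinations by a product of expectations, without computing a convolution, and
it includes the degenerate case $v = 0$. *)
Definition has_gaussian_mgf (v : R) (Y : T -> R) : Prop :=
  forall t, (\int[P]_w (expR (t * Y w))%:E = (expR (t ^+ 2 * v / 2))%:E)%E.

Lemma gaussian_law_mgf (v : R) (Z : {RV P >-> R}) : 0 <= v ->
  has_gaussian_law 0 v Z -> has_gaussian_mgf v Z.
Proof.
move=> v0 hZ t.
have mZ : measurable_fun setT (Z : T -> measurableTypeR R).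
  exact: (measurable_funPT Z).
pose Z' : {mfun T >-> measurableTypeR R} :=
  @mfun_Sub _ _ T (measurableTypeR R) Z (mem_set mZ).
have mexp : measurable_fun setT (fun x : measurableTypeR R => (expR (t * x))%:E).
  apply/measurable_EFinP; apply: measurableT_comp => //.
transitivity (\int[distribution P Z']_x (expR (t * x))%:E)%E.
  by rewrite ge0_integral_distribution.
move: hZ; rewrite /has_gaussian_law /gaussian.
have [->|vn0] := eqVneq v 0 => hZ.
  transitivity (\int[\d_((0%R : R) : measurableTypeR R)]_x (expR (t * x))%:E)%E.
    by apply: eq_measure_integral => A mA _; exact: hZ.
  by rewrite integral_dirac//= !mulr0 mul0r expR0 mule1 diracT.
transitivity (\int[normal_prob 0%R (Num.sqrt v)]_x (expR (t * x))%:E)%E.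
  by apply: eq_measure_integral => A mA _; exact: hZ.
by rewrite normal_prob_mgf ?sqr_sqrtr// sqrtr_eq0 -ltNge lt_def vn0.
Qed.

(** Exponential Markov inequality for both signs at once. The parameter [t] is left
free because its optimal value involves a division by [v], which may vanish. *)
Lemma mgf_tail (v t s : R) (Y : T -> R) : measurable_fun setT Y ->
  has_gaussian_mgf v Y -> 0 <= t ->
  (P [set w | (s < `|Y w|)%R] <= (2 * expR (t ^+ 2 * v / 2 - t * s))%:E)%E.
Proof.
move=> mY hY t0.
have mA : measurable [set w | s < `|Y w|].
  apply: measurable_set_lt => //.
  exact: measurableT_comp.
have mE c := measurable_expR_scale c mY.
apply: le_trans (prob_le_integral P (g := fun w =>
  expR (- (t * s)) * (expR (t * Y w) + expR (- t * Y w))) mA _ _ _) _.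
- by apply: measurable_funM => //; exact: measurable_funD.
- by move=> w; rewrite mulr_ge0 ?expR_ge0// addr_ge0 ?expR_ge0.
- move=> w /= sY; rewrite mulrDr -!expRD -[leLHS]expR0.
  have [Y0|Y0] := leP 0 (Y w).
    rewrite ger0_norm// in sY.
    apply: le_trans (_ : expR (- (t * s) + t * Y w) <= _); last by rewrite lerDl expR_ge0.
    by rewrite ler_expR addrC subr_ge0; apply: ler_wpM2l => //; exact: ltW.
  rewrite ltr0_norm// in sY.
  apply: le_trans (_ : expR (- (t * s) + - t * Y w) <= _); last by rewrite lerDr expR_ge0.
  by rewrite ler_expR addrC mulNr -mulrN subr_ge0; apply: ler_wpM2l => //; exact: ltW.
rewrite ge0_integral_scaleR ?expR_ge0//; last exact: measurable_funD.
rewrite ge0_integral_addR// !hY.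
rewrite sqrrN -EFinD -EFinM lee_fin expRD le_eqVlt; apply/orP; left.
by apply/eqP; ring.
Qed.

Lemma linear_mgf (I : finType) (A : eqType) (v : R) (Z : I -> {RV P >-> R})
    (s : seq A) (h : A -> I) (c : A -> R) :
  mutually_independent Z -> uniq s -> injective h ->
  (forall i, has_gaussian_mgf v (Z i)) ->
  has_gaussian_mgf (v * \sum_(a <- s) c a ^+ 2)
    (fun w => \sum_(a <- s) c a * Z (h a) w).
Proof.
move=> ind us hI hZ t.
under eq_integral do rewrite mulr_sumr expR_sum.
rewrite (expect_blocks_mul ind (B := fun a => [set h a]%SET))//.
- under eq_bigr => a _.
    under eq_integral => w _ do rewrite mulrA.
    rewrite hZ; over.
  rewrite prodEFin -expR_sum; congr (expR _)%:E.
  rewrite mulr_sumr mulr_sumr mulr_suml; apply: eq_bigr => i _; ring.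
- by move=> a b _ _ ab; rewrite disjoints1 inE (inj_eq hI).
- move=> a _; apply: measurableT_comp => //; apply: measurable_funM => //.
  apply: measurable_funM => //.
  by apply: measurable_sub_space; rewrite inE.
Qed.

End Mgf.

(** * Exponential lower tail of the chi-square law *)

Section ScalarInequalities.
Context {R : realType}.
Implicit Types x y e : R.

Lemma expRN_ub x : 0 <= x -> expR (- x) <= 1 - x + x ^+ 2.
Proof.
move=> x0; have h1 : 1 + x <= expR x by exact: expR_ge1Dx.
have h2 : expR (- x) * expR x = 1 by rewrite -expRD addNr expR0.
have h3 : 0 < expR (- x) by exact: expR_gt0.
have h4 : expR (- x) * (1 + x) <= 1 by rewrite -[leRHS]h2 ler_wpM2l// ltW.
have x10 : 0 < 1 + x by lra.
rewrite -(ler_pM2r x10); apply: le_trans h4 _.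
have : 0 <= x ^+ 3 by exact: exprn_ge0.
move=> x3; have -> : (1 - x + x ^+ 2) * (1 + x) = 1 + x ^+ 3 by ring.
lra.
Qed.

Lemma expR_ub x : 0 <= x <= 2^-1 -> expR x <= 1 + x + 2 * x ^+ 2.
Proof.
move=> /andP[x0 x1]; have h1 : 1 + - x <= expR (- x) by exact: expR_ge1Dx.
have h2 : expR (- x) * expR x = 1 by rewrite -expRD addNr expR0.
have h3 : 0 < expR x by exact: expR_gt0.
have h4 : (1 - x) * expR x <= 1 by rewrite -[leRHS]h2 ler_wpM2r// ltW.
have x10 : 0 < 1 - x by lra.
rewrite -(ler_pM2l x10); apply: le_trans h4 _.
have : 0 <= x ^+ 2 * (1 - 2 * x) by apply: mulr_ge0; [exact: sqr_ge0|lra].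
move=> x3; have -> : (1 - x) * (1 + x + 2 * x ^+ 2) = 1 + x ^+ 2 * (1 - 2 * x) by ring.
lra.
Qed.

(** Since $\sinh x \le x e^x$ and $e^{-x} \ge 1 - \sinh x$ for $x \ge 0$, one has
$x \ge \sinh x (1 - \sinh x)$. Squaring, and absorbing the cubic term by the
inequality of arithmetic and geometric means, bounds $x^2$ from below by a
polynomial in $\sinh^2 x$, that is, by exponentials of linear functions of $x$. *)
Lemma sinh_sqr_le x e : 0 < e ->
  let S := (expR x - expR (- x)) / 2 in (1 - e) * S ^+ 2 - S ^+ 4 / e <= x ^+ 2.
Proof.
move=> e0; wlog x0 : x / 0 <= x.
  move=> H; have [/H//|x0] := leP 0 x.
  have x0' : 0 <= - x by lra.
  have := H (- x) x0'; rewrite opprK /=.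
  have -> : (expR (- x) - expR x) / 2 = - ((expR x - expR (- x)) / 2) by ring.
  by rewrite !sqrrN (_ : (- _) ^+ 4 = ((expR x - expR (- x)) / 2) ^+ 4)//; ring.
rewrite /=; set S := (_ / 2).
have h2 : expR x * expR (- x) = 1 by rewrite -expRD addrN expR0.
have p0 := expR_gt0 x; have q0 := expR_gt0 (- x).
have h3 : 1 + x <= expR x by exact: expR_ge1Dx.
have h3' : 1 + - x <= expR (- x) by exact: expR_ge1Dx.
have S0 : 0 <= S.
  suff : expR (- x) <= expR x by rewrite /S; lra.
  by rewrite ler_expR; lra.
have Sq : S * expR (- x) <= x.
  have h4 : 1 + - (2 * x) <= expR (- (2 * x)) by exact: expR_ge1Dx.
  have h5 : expR (- (2 * x)) = expR (- x) * expR (- x) by rewrite -expRD; congr expR; ring.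
  have -> : S * expR (- x) = (1 - expR (- (2 * x))) / 2.
    by rewrite /S mulrAC mulrBl h2 h5.
  lra.
have q1 : 1 - S <= expR (- x) by rewrite /S; lra.
have xS : S * (1 - S) <= x.
  by apply: le_trans Sq; rewrite ler_wpM2l.
have key : 2 * S ^+ 3 <= e * S ^+ 2 + S ^+ 4 / e.
  have : 0 <= S ^+ 2 * (e - S) ^+ 2 / e.
    by apply: divr_ge0; [apply: mulr_ge0; exact: sqr_ge0|exact: ltW].
  have en0 : e != 0 by rewrite gt_eqF.
  have -> : S ^+ 2 * (e - S) ^+ 2 / e = e * S ^+ 2 + S ^+ 4 / e - 2 * S ^+ 3 by field.
  lra.
have [S1|S1] := leP S 1.
  have : (S * (1 - S)) ^+ 2 <= x ^+ 2.
    by rewrite ler_sqr ?nnegrE//; apply: mulr_ge0 => //; lra.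
  have -> : (S * (1 - S)) ^+ 2 = S ^+ 2 - 2 * S ^+ 3 + S ^+ 4 by ring.
  have : 0 <= S ^+ 4 by exact: exprn_ge0.
  lra.
have : 0 <= x ^+ 2 by exact: sqr_ge0.
have : 0 <= S ^+ 2 * (S - 1) by apply: mulr_ge0; [exact: sqr_ge0|lra].
have : 0 <= S ^+ 2 by exact: sqr_ge0.
have -> : S ^+ 2 * (S - 1) = S ^+ 3 - S ^+ 2 by ring.
lra.
Qed.

Lemma expR_quartic x : x ^+ 4 <= 24 * (expR x + expR (- x)).
Proof.
wlog x0 : x / 0 <= x.
  move=> H; have [/H//|x0] := leP 0 x.
  have := H (- x); rewrite opprK [expR (- x) + _]addrC => H'.
  have -> : x ^+ 4 = (- x) ^+ 4 by ring.
  by apply: H'; lra.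
have h : 1 + x ^+ 4 / 24 <= expR x := expR_ge1Dxn 3 x0.
have := expR_gt0 (- x); lra.
Qed.

(** Pointwise inequality behind the Laplace transform of the square of a Gaussian
variable. It combines $e^{-y} \le 1 - y + y^2$ at $y = s x^2$ with the lower bound
[sinh_sqr_le] at $th\, x / 2$ for the linear term and the bound [expR_quartic] for
the quadratic one. It is arranged with positive coefficients on both sides, so that it
can be integrated term by term without any integrability condition. *)
Lemma expR_sqr_le_mgf x th s e : 0 < th -> 0 <= s -> 0 < e ->
  let k := 4 * s / th ^+ 2 in
  expR (- (s * x ^+ 2)) + (k * (1 - e) / 4 + k / (4 * e)) * (expR (th * x) + expR (- th * x))
  <= (1 + k * (1 - e) / 2 + 6 * (k / (16 * e)))
     + (k / (16 * e)) * (expR (2 * th * x) + expR (- (2 * th) * x))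
     + 24 * s ^+ 2 * (expR (1 * x) + expR (- 1 * x)).
Proof.
move=> th0 s0 e0; rewrite /=; set k := 4 * s / th ^+ 2.
have thn0 : th != 0 by rewrite gt_eqF.
have en0 : e != 0 by rewrite gt_eqF.
have k0 : 0 <= k by rewrite /k divr_ge0 ?sqr_ge0// mulr_ge0.
have h1 := expRN_ub (mulr_ge0 s0 (sqr_ge0 x)).
have h2 := sinh_sqr_le (th * x / 2) e0; rewrite /= in h2.
have h3 : (s * x ^+ 2) ^+ 2 <= 24 * s ^+ 2 * (expR x + expR (- x)).
  have -> : (s * x ^+ 2) ^+ 2 = s ^+ 2 * x ^+ 4 by ring.
  apply: le_trans (ler_wpM2l (sqr_ge0 s) (expR_quartic x)) _.
  by rewrite le_eqVlt; apply/orP; left; apply/eqP; ring.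
rewrite mul1r mulN1r.
set p := expR (th * x / 2) in h2; set q := expR (- (th * x / 2)) in h2.
have pq : p * q = 1 by rewrite -expRD addrN expR0.
have -> : expR (th * x) = p ^+ 2 by rewrite -expRM_natl; congr expR; field.
have -> : expR (- th * x) = q ^+ 2 by rewrite -expRM_natl; congr expR; field.
have -> : expR (2 * th * x) = p ^+ 4 by rewrite -expRM_natl; congr expR; field.
have -> : expR (- (2 * th) * x) = q ^+ 4 by rewrite -expRM_natl; congr expR; field.
have S2 : ((p - q) / 2) ^+ 2 = (p ^+ 2 + q ^+ 2 - 2) / 4.
  have -> : ((p - q) / 2) ^+ 2 = (p ^+ 2 + q ^+ 2 - 2 * (p * q)) / 4 by field.
  by rewrite pq mulr1.
have S4 : ((p - q) / 2) ^+ 4 = (p ^+ 4 + q ^+ 4 + 6 - 4 * p ^+ 2 - 4 * q ^+ 2) / 16.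
  have -> : ((p - q) / 2) ^+ 4 = (p ^+ 4 + q ^+ 4 + 6 * (p * q) ^+ 2
     - 4 * (p * q) * p ^+ 2 - 4 * (p * q) * q ^+ 2) / 16 by field.
  by rewrite pq expr1n !mulr1.
rewrite S2 S4 in h2.
have h4 := ler_wpM2l k0 h2.
have E1 : k * (th * x / 2) ^+ 2 = s * x ^+ 2 by rewrite /k; field.
rewrite E1 in h4.
move: h1 h3 h4; move: (expR (- (s * x ^+ 2))) (expR x + expR (- x)) => u v h1 h3 h4.
have -> : (k * (1 - e) / 4 + k / (4 * e)) * (p ^+ 2 + q ^+ 2) =
   (1 + k * (1 - e) / 2 + 6 * (k / (16 * e))) + k / (16 * e) * (p ^+ 4 + q ^+ 4) - 1
   + k * ((1 - e) * ((p ^+ 2 + q ^+ 2 - 2) / 4) -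
     (p ^+ 4 + q ^+ 4 + 6 - 4 * p ^+ 2 - 4 * q ^+ 2) / 16 / e) by field.
lra.
Qed.

End ScalarInequalities.

Section ChiSquare.
Context {R : realType} {d : measure_display} {T : measurableType d}.
Variable (P : probability T R).

(** To first order in [s] this is $e^{-s E[U^2]}$ with $E[U^2] = 1$. The scales
$th = 48 s$ and $e = 96 s$ make the three error terms of [expR_sqr_le_mgf] equal, each to
$96 s^2$ after integration. *)
Lemma gaussian_sqr_laplace (U : T -> R) (s : R) : measurable_fun setT U ->
  has_gaussian_mgf P 1 U -> 0 < s -> 96 * s <= 1 ->
  (\int[P]_w (expR (- (s * U w ^+ 2)))%:E <= (expR (- (s * (1 - 288 * s))))%:E)%E.
Proof.
move=> mU hU s0' s1.
have [th thE] : exists th, th = 48 * s by exists (48 * s).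
have [e eE] : exists e, e = 96 * s by exists (96 * s).
pose k := 4 * s / th ^+ 2.
pose D := k * (1 - e) / 4 + k / (4 * e).
pose F := k / (16 * e).
pose c := 1 + k * (1 - e) / 2 + 6 * F.
have th0 : 0 < th by lra.
have s0 : 0 <= s by lra.
have e0 : 0 < e by lra.
have k0 : 0 <= k by rewrite divr_ge0 ?sqr_ge0// mulr_ge0.
have e1 : 0 <= 1 - e by lra.
have F0 : 0 <= F by apply: divr_ge0 => //; lra.
have ke0 : 0 <= k * (1 - e) by exact: mulr_ge0.
have ke1 : 0 <= k / (4 * e) by apply: divr_ge0 => //; lra.
have D0 : 0 <= D by rewrite /D; lra.
have c0 : 0 <= c by rewrite /c; lra.
have mE t := measurable_expR_scale t mU.
have mG : measurable_fun setT (fun w => expR (- (s * U w ^+ 2))).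
  apply: measurableT_comp => //; apply: measurableT_comp => //.
  by apply: measurable_funM => //; exact: measurable_funX.
have m2 t : measurable_fun setT (fun w => expR (t * U w) + expR (- t * U w)).
  exact: measurable_funD.
have g2 t w : 0 <= expR (t * U w) + expR (- t * U w).
  by rewrite addr_ge0 ?expR_ge0.
have I2 t : (\int[P]_w (expR (t * U w) + expR (- t * U w))%:E =
    (2 * expR (t ^+ 2 / 2))%:E)%E.
  rewrite ge0_integral_addR// !hU sqrrN -EFinD !mulr1; congr _%:E; ring.
have := le_integralR P _ _ _ (fun w => expR_sqr_le_mgf (U w) th0 s0 e0).
rewrite -/k -/D -/F -/c.
rewrite ge0_integral_addR//; last 2 first.
- exact: measurable_funM.
- by move=> w; rewrite mulr_ge0.
rewrite ge0_integral_scaleR// I2.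
rewrite ge0_integral_addR//; last 4 first.
- by apply: measurable_funD => //; exact: measurable_funM.
- by apply: measurable_funM => //; exact: measurable_funM.
- by move=> w; rewrite addr_ge0// mulr_ge0.
- by move=> w; rewrite !mulr_ge0// exprn_ge0.
rewrite ge0_integral_addR//; last 2 first.
- exact: measurable_funM.
- by move=> w; rewrite mulr_ge0.
rewrite !ge0_integral_scaleR// ?I2; last by rewrite mulr_ge0// exprn_ge0.
rewrite integral_cstR -!EFinM -!EFinD.
move=> H.
have mD t k' : measurable_fun setT
    (fun w => k' * (expR (t * U w) + expR (- t * U w))) by exact: measurable_funM.
have {H} := H (measurable_funD mG (mD th D))
  (measurable_funD (measurable_funD (measurable_cst _) (mD (2 * th) F)) (mD 1 _))
  (fun w => addr_ge0 (expR_ge0 _) (mulr_ge0 D0 (g2 th w))).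
rewrite -leeBrDr// -EFinB => /le_trans; apply; rewrite lee_fin.
have A1 : 1 + th ^+ 2 / 2 <= expR (th ^+ 2 / 2) by exact: expR_ge1Dx.
have A2 : expR ((2 * th) ^+ 2 / 2) <= 1 + 2 * th ^+ 2 + 8 * th ^+ 4.
  apply: le_trans (expR_ub _) _; last first.
    rewrite le_eqVlt; apply/orP; left; apply/eqP; by field.
  apply/andP; split; first by apply: divr_ge0 => //; exact: sqr_ge0.
  have : (96 * s) ^+ 2 <= 1 ^+ 2 by rewrite ler_sqr ?nnegrE; lra.
  by rewrite expr1n thE (_ : (2 * (48 * s)) ^+ 2 = (96 * s) ^+ 2); [lra|ring].
have A3 : expR (1 ^+ 2 / 2) <= 2 :> R.
  have := @expR_ub R (1 ^+ 2 / 2); rewrite expr1n => /(_ _)/le_trans; apply; lra.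
have A4 : 1 - s * (1 - 288 * s) <= expR (- (s * (1 - 288 * s))) by exact: expR_ge1Dx.
apply: le_trans A4.
have s2 : 0 <= s ^+ 2 by exact: sqr_ge0.
have B1 := ler_wpM2l D0 A1.
have B2 := ler_wpM2l F0 A2.
have B3 := ler_wpM2l s2 A3.
have sn0 : s != 0 by rewrite gt_eqF.
have -> : 1 - s * (1 - 288 * s) = c + F * (2 * (1 + 2 * th ^+ 2 + 8 * th ^+ 4))
    + 24 * s ^+ 2 * (2 * 2) - D * (2 * (1 + th ^+ 2 / 2)).
  by rewrite /c /D /F /k thE eE; field.
lra.
Qed.

(** The rows of the matrix are independent, and each coordinate of the image of [w],
once normalized, has the moment generating function of a standard Gaussian
variable. So this is the Chernoff bound for the lower tail of a chi-square variable
with [n] degrees of freedom. *)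
Lemma gaussian_image_lower_tail (n m p : nat) (X : 'I_n * 'I_p -> {RV P >-> R})
    (f : 'I_m -> 'I_p) (w : 'I_m -> R) (z : R) :
  (0 < n)%N -> mutually_independent X ->
  (forall i, has_gaussian_mgf P (1 / n%:R) (X i)) -> injective f ->
  0 < z <= 1 ->
  (P [set x | (\sum_i (\sum_j w j * X (i, f j) x) ^+ 2 < (1 - z) * \sum_j w j ^+ 2)%R]
   <= (expR (- (z ^+ 2 / 1280 * n%:R)))%:E)%E.
Proof.
move=> n0 ind hX fI /andP[z0 z1].
have nR0 : 0 < n%:R :> R by rewrite ltr0n.
set W := \sum_j w j ^+ 2.
have W0 : 0 <= W by apply: sumr_ge0 => j _; exact: sqr_ge0.
pose Y i x := \sum_j w j * X (i, f j) x.
have mY i : measurable_fun setT (Y i).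
  by apply: measurable_sum => j; exact: measurable_funM.
have mA : measurable [set x | \sum_i (Y i x) ^+ 2 < (1 - z) * W].
  apply: measurable_set_lt => //.
  by apply: measurable_sum => i; exact: measurable_funX.
have [W00|Wn0] := eqVneq W 0.
  rewrite [X in P X](_ : _ = set0) ?measure0 ?lee_fin ?expR_ge0//.
  apply/seteqP; split=> x //=; rewrite W00 mulr0 ltNge => /negP; apply.
  by apply: sumr_ge0 => i _; exact: sqr_ge0.
have {Wn0}W0 : 0 < W by rewrite lt_def Wn0.
(* The factor that normalizes the coordinates of the image of [w] to variance one. *)
pose r := Num.sqrt (n%:R / W).
have r2 : r ^+ 2 = n%:R / W by rewrite sqr_sqrtr// divr_ge0 ?ltW.
pose U i x := r * Y i x.
have mU i : measurable_fun setT (U i) by exact: measurable_funM.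
have hU i : has_gaussian_mgf P 1 (U i).
  have hI : injective (fun j => (i, f j)) by move=> a b [/fI].
  have := linear_mgf (h := fun j => (i, f j)) (fun j => r * w j) ind
    (index_enum_uniq 'I_m) hI hX.
  have -> : 1 / n%:R * \sum_j (r * w j) ^+ 2 = 1.
    under eq_bigr do rewrite exprMn.
    rewrite -mulr_sumr r2 -/W; have : n%:R != 0 :> R by rewrite gt_eqF.
    by move=> ?; field; rewrite gt_eqF.
  by congr (has_gaussian_mgf P 1 _); apply/funext => x; rewrite /U /Y mulr_sumr;
    apply: eq_bigr => j _; rewrite mulrA.
(* With this value the exponent of [gaussian_sqr_laplace] is $s (1 - 3 z / 8)$; the gap
to $s (1 - z)$ is $5 s z / 8$, slightly more than $z^2 / 1280$. *)
pose s := z / 768.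
have s0 : 0 < s by rewrite /s; lra.
pose g i x := expR (- (s * U i x ^+ 2)).
have mg i : measurable_fun setT (g i).
  apply: measurableT_comp => //; apply: measurableT_comp => //.
  by apply: measurable_funM => //; exact: measurable_funX.
have mprod : measurable_fun setT (fun x => \prod_i g i x).
  by apply: measurable_prod => i _; exact: mg.
have prod0 x : 0 <= \prod_i g i x by apply: prodr_ge0 => i _; exact: expR_ge0.
apply: le_trans (prob_le_integral P
  (g := fun x => expR (s * (1 - z) * n%:R) * \prod_i g i x) mA _ _ _) _.
- exact: measurable_funM.
- by move=> x; rewrite mulr_ge0 ?expR_ge0.
- move=> x /= YW; rewrite -expR_sum -expRD -[leLHS]expR0 ler_expR sumrN.
  have -> : \sum_i s * U i x ^+ 2 = s * (n%:R / W * \sum_i (Y i x) ^+ 2).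
    rewrite -r2 !mulr_sumr; apply: eq_bigr => i _; rewrite /U exprMn; ring.
  have : n%:R / W * \sum_i (Y i x) ^+ 2 <= n%:R / W * ((1 - z) * W).
    by apply: ler_wpM2l; [rewrite divr_ge0 ?ltW|exact: ltW].
  have -> : n%:R / W * ((1 - z) * W) = (1 - z) * n%:R by field; rewrite gt_eqF.
  move=> /(ler_wpM2l (ltW s0)).
  rewrite subr_ge0 => /le_trans; apply; rewrite le_eqVlt; apply/orP; left.
  by apply/eqP; ring.
rewrite ge0_integral_scaleR ?expR_ge0//.
rewrite (expect_blocks_mul ind (B := fun i => [set x | x.1 == i]%SET))//; last 4 first.
- exact: index_enum_uniq.
- move=> a b _ _ ab; rewrite disjoint_subset; apply/fintype.subsetP => -[i j].
  by rewrite !inE/= => /eqP ->.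
- move=> i _; apply: measurableT_comp => //; apply: measurableT_comp => //.
  apply: measurable_funM => //; apply: measurable_funX; apply: measurable_funM => //.
  apply: measurable_sum => j; apply: measurable_funM => //.
  by apply: measurable_sub_space; rewrite inE.
- by move=> i x; exact: expR_ge0.
have prodle (r' : seq 'I_n) :
    (\prod_(i <- r') \int[P]_x (g i x)%:E <=
     \prod_(i <- r') (expR (- (s * (1 - 288 * s))))%:E)%E.
  elim: r' => [|i r' IH]; first by rewrite !big_nil.
  rewrite !big_cons; apply: lee_pmul => //.
  - by apply: integral_ge0 => x _; rewrite lee_fin expR_ge0.
  - by apply: prode_ge0 => j _; apply: integral_ge0 => x _; rewrite lee_fin expR_ge0.
  - by apply: gaussian_sqr_laplace => //; rewrite /s; lra.
apply: le_trans (lee_wpmul2l _ (prodle _)) _; first by rewrite lee_fin expR_ge0.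
rewrite prodEFin -EFinM lee_fin -expR_sum -expRD ler_expR.
rewrite sumr_const card_ord -mulr_natr /s.
have : 0 <= z ^+ 2 * n%:R by rewrite mulr_ge0 ?sqr_ge0 ?ltW.
lra.
Qed.

End ChiSquare.

(** * Union bounds and tails of Gaussian matrices *)

Section UnionBound.
Context {R : realType} {d : measure_display} {T : measurableType d}.
Variable (P : probability T R).

Lemma union_bound_measurable (K : finType) (Q : K -> set T) :
  (forall k, measurable (Q k)) -> measurable [set x | exists k, Q k x].
Proof.
move=> mQ; have -> : [set x | exists k, Q k x] = \big[setU/set0]_(k : K) Q k.
  rewrite -bigcup_seq; apply/seteqP; split=> [x [k Qk]|x [k _ Qk]]; last by exists k.
  by exists k => //=; rewrite mem_index_enum.
exact: bigsetU_measurable.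
Qed.

Lemma union_bound (K : finType) (Q : K -> set T) :
  (forall k, measurable (Q k)) ->
  (P [set x | exists k, Q k x] <= \sum_k P (Q k))%E.
Proof.
move=> mQ; have -> : [set x | exists k, Q k x] = \big[setU/set0]_(k : K) Q k.
  rewrite -bigcup_seq; apply/seteqP; split=> [x [k Qk]|x [k _ Qk]]; last by exists k.
  by exists k => //=; rewrite mem_index_enum.
elim: (index_enum K) => [|k s IH]; first by rewrite !big_nil measure0.
rewrite !big_cons; apply: le_trans (leeD2l _ IH).
by apply: measureU2 => //; exact: bigsetU_measurable.
Qed.

Lemma union_bound_const (K : finType) (Q : K -> set T) (q : R) :
  (forall k, measurable (Q k)) -> (forall k, (P (Q k) <= q%:E)%E) ->
  (P [set x | exists k, Q k x] <= (#|K|%:R * q)%:E)%E.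
Proof.
move=> mQ Qq; apply: le_trans (union_bound mQ) _.
apply: le_trans (_ : \sum_(k : K) q%:E <= _)%E; first by apply: lee_sum => k _.
by rewrite sumEFin sumr_const mulr_natl lee_fin.
Qed.

End UnionBound.


Section MatrixTails.
Context {R : realType} {d : measure_display} {T : measurableType d}.
Variable (P : probability T R).

(** With the variables of [J] frozen, the sum is a linear combination of independent
Gaussian variables with variance at most $B / n$; [decoupling_prob_le] removes the
freezing. The constraint on the coefficients is part of the event because it holds
only on a good event of the variables of [J]. *)
Lemma cross_tail (n p : nat) (X : 'I_n * 'I_p -> {RV P >-> R})
    (J : {set 'I_n * 'I_p}) (j : 'I_p) (u : 'I_n -> T -> R) (B s : R) :
  (0 < n)%N -> mutually_independent X ->
  (forall i, has_gaussian_mgf P (1 / n%:R) (X i)) ->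
  (forall i, (i, j) \notin J) -> 0 < B -> 0 <= s ->
  (forall i, measurable_fun setT (u i : sub_space X J -> R)) ->
  (P [set x | (\sum_i u i x ^+ 2 <= B)%R /\ (s < `|\sum_i u i x * X (i, j) x|)%R]
   <= (2 * expR (- (n%:R * s ^+ 2 / (2 * B))))%:E)%E.
Proof.
move=> n0 ind hX jJ B0 s0 mu.
have nR0 : 0 < n%:R :> R by rewrite ltr0n.
have nn0 : n%:R != 0 :> R by rewrite gt_eqF.
pose K := [set x : 'I_n * 'I_p | x.2 == j]%SET.
have mu1 i : measurable_fun setT (fun y : sub_space X J * sub_space X K => u i y.1).
  exact: (measurableT_comp (mu i)).
have mX2 i : measurable_fun setT (fun y : sub_space X J * sub_space X K => X (i, j) y.2).
  have mXK : measurable_fun setT (X (i, j) : sub_space X K -> R).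
    by apply: measurable_sub_space; rewrite inE.
  exact: (measurableT_comp mXK).
apply: (decoupling_prob_le ind (J := J) (K := K) (S :=
  [set y | \sum_i u i y.1 ^+ 2 <= B] `&`
  [set y | s < `|\sum_i u i y.1 * X (i, j) y.2|])).
- rewrite disjoint_subset; apply/fintype.subsetP => -[i k] iJ; rewrite !inE/=.
  by apply/negP => /eqP kj; have := jJ i; rewrite -kj iJ.
- apply: measurableI.
    apply: measurable_set_le => //; apply: measurable_sum => i.
    exact: measurable_funX.
  apply: measurable_set_lt => //; apply: measurableT_comp => //.
  by apply: measurable_sum => i; exact: measurable_funM.
move=> w1; have [uB|uB] := leP (\sum_i u i w1 ^+ 2) B; last first.
  rewrite [X in P X](_ : _ = set0) ?measure0 ?lee_fin ?mulr_ge0 ?expR_ge0//.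
  by apply/seteqP; split=> // w2 [/=]; rewrite leNgt uB.
have hI : injective (fun i : 'I_n => (i, j)) by move=> a b [].
have hU := linear_mgf (h := fun i => (i, j)) (fun i => u i w1) ind
    (index_enum_uniq 'I_n) hI hX.
have mU : measurable_fun setT (fun w2 => \sum_i u i w1 * X (i, j) w2).
  by apply: measurable_sum => i; exact: measurable_funM.
(* The optimal exponent for a Gaussian variable of variance $B / n$. *)
have t0 : 0 <= n%:R * s / B by rewrite divr_ge0 ?mulr_ge0// ltW.
apply: (@le_trans _ _ (P [set w2 | (s < `|\sum_i u i w1 * X (i, j) w2|)%R])).
  apply: le_measure; rewrite ?inE; last by move=> w2 [].
    rewrite [X in measurable X](_ : _ = [set w2 | s < `|\sum_i u i w1 * X (i, j) w2|]).
      by apply: measurable_set_lt => //; exact: measurableT_comp.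
    by apply/seteqP; split=> w2 /= [].
  by apply: measurable_set_lt => //; exact: measurableT_comp.
apply: le_trans (mgf_tail s mU hU t0) _.
rewrite lee_fin ler_pM2l// ler_expR.
have Bn0 : B != 0 by rewrite gt_eqF.
have -> : - (n%:R * s ^+ 2 / (2 * B)) =
  (n%:R * s / B) ^+ 2 * (1 / n%:R * B) / 2 - n%:R * s / B * s.
  by field; rewrite ?nn0 ?Bn0.
by rewrite lerD2r ler_pM2r ?invr_gt0// ler_wpM2l ?sqr_ge0// ler_wpM2l//.
Qed.

Lemma sqr_le_expR (x : R) : x ^+ 2 <= 2 * (expR x + expR (- x)).
Proof.
wlog x0 : x / 0 <= x.
  move=> H; have [/H//|x0] := leP 0 x.
  have := H (- x); rewrite opprK [expR (- x) + _]addrC => H'.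
  have -> : x ^+ 2 = (- x) ^+ 2 by ring.
  by apply: H'; lra.
have h : 1 + x ^+ 2 / 2 <= expR x := expR_ge1Dxn 1 x0.
have := expR_gt0 (- x); lra.
Qed.

(** Markov's inequality; $y^2 \le 2 (e^y + e^{-y})$ at $y = \sqrt n\, X_{ij}$ bounds the
second moment of the entries. *)
Lemma frobenius_tail (n m p : nat) (X : 'I_n * 'I_p -> {RV P >-> R})
    (f : 'I_m -> 'I_p) (C : R) :
  (0 < n)%N -> (0 < m)%N -> 0 < C ->
  (forall i, has_gaussian_mgf P (1 / n%:R) (X i)) ->
  (P [set x | (C * m%:R < \sum_i \sum_j X (i, f j) x ^+ 2)%R] <= (8 / C)%:E)%E.
Proof.
move=> n0 m0 C0 hX.
have nR0 : 0 < n%:R :> R by rewrite ltr0n.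
have mR0 : 0 < m%:R :> R by rewrite ltr0n.
have nn0 : n%:R != 0 :> R by rewrite gt_eqF.
have mA : measurable [set x | C * m%:R < \sum_i \sum_j X (i, f j) x ^+ 2].
  apply: measurable_set_lt => //; apply: measurable_sum => i.
  by apply: measurable_sum => j; exact: measurable_funX.
pose r := Num.sqrt n%:R : R.
have r2 : r ^+ 2 = n%:R by rewrite sqr_sqrtr// ltW.
pose h i j x := expR (r * X (i, f j) x) + expR (- r * X (i, f j) x).
have mh i j : measurable_fun setT (h i j).
  by apply: measurable_funD; exact: measurable_expR_scale.
have h0 i j x : 0 <= h i j x by rewrite addr_ge0 ?expR_ge0.
have msum : measurable_fun setT (fun x => \sum_i \sum_j h i j x).
  by apply: measurable_sum => i; apply: measurable_sum => j.
have c0 : 0 <= 2 / (C * m%:R * n%:R) :> R by rewrite divr_ge0// !mulr_ge0// ltW.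
apply: le_trans (prob_le_integral P (g := fun x =>
  2 / (C * m%:R * n%:R) * \sum_i \sum_j h i j x) mA _ _ _) _.
- exact: measurable_funM.
- by move=> x; rewrite mulr_ge0//; apply: sumr_ge0 => i _; apply: sumr_ge0.
- move=> x /= xA.
  have cc : 0 < C * m%:R * n%:R by rewrite !mulr_gt0.
  rewrite mulrAC ler_pdivlMr// mul1r.
  apply: le_trans (_ : n%:R * \sum_i \sum_j X (i, f j) x ^+ 2 <= _).
    by rewrite mulrC ler_pM2l// ltW.
  rewrite !mulr_sumr; apply: ler_sum => i _; rewrite !mulr_sumr; apply: ler_sum => j _.
  have := sqr_le_expR (r * X (i, f j) x).
  by rewrite exprMn r2 /h mulNr.
have intE : (\int[P]_x (\sum_i \sum_j h i j x)%:E <= (n%:R * m%:R * 4)%:E)%E.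
  have inth i j : (\int[P]_x (h i j x)%:E <= 4%:E)%E.
    rewrite ge0_integral_addR//; try (by move=> ?; exact: expR_ge0);
      try exact: measurable_expR_scale.
    rewrite !hX sqrrN r2 -EFinD lee_fin mul1r divff//.
    have : expR (1 / 2) <= 1 + (1 / 2) + 2 * (1 / 2) ^+ 2 :> R by apply: expR_ub; lra.
    lra.
  under eq_integral do rewrite -sumEFin.
  rewrite ge0_integral_sum//; last 2 first.
  - move=> i; apply/measurable_EFinP; apply: measurable_sum => j; exact: mh.
  - by move=> i x _; rewrite lee_fin; apply: sumr_ge0.
  apply: (@le_trans _ _ (\sum_(i < n) (m%:R * 4)%:E)%E); last first.
    by rewrite sumEFin sumr_const card_ord lee_fin -[leLHS]mulr_natl mulrA.
  apply: lee_sum => i _; under eq_integral do rewrite -sumEFin.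
  rewrite ge0_integral_sum//; last 2 first.
  - by move=> j; apply/measurable_EFinP; exact: mh.
  - by move=> j x _; rewrite lee_fin.
  apply: (@le_trans _ _ (\sum_(j < m) 4%:E)%E); last first.
    by rewrite sumEFin sumr_const card_ord lee_fin -[leLHS]mulr_natl.
  by apply: lee_sum => j _.
rewrite ge0_integral_scaleR//; last first.
  by move=> x; apply: sumr_ge0 => i _; apply: sumr_ge0.
apply: le_trans (lee_wpmul2l _ intE) _; first by rewrite lee_fin.
rewrite -EFinM lee_fin le_eqVlt; apply/orP; left; apply/eqP.
by field; rewrite nn0 !gt_eqF.
Qed.

Lemma max_entry_tail (K : finType) (v : R) (Z : K -> {RV P >-> R}) (t s : R) :
  (forall i, has_gaussian_mgf P v (Z i)) -> 0 <= t ->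
  (P [set x | exists i, (s < `|Z i x|)%R] <=
    (#|K|%:R * (2 * expR (t ^+ 2 * v / 2 - t * s)))%:E)%E.
Proof.
move=> hZ t0; apply: union_bound_const => [i|i].
  by apply: measurable_set_lt => //; exact: measurableT_comp.
exact: mgf_tail.
Qed.

End MatrixTails.

(** * Lower bound on the smallest singular value by a lattice net *)

Section Net.
Context {R : realType}.
Variables (n m : nat) (a : 'I_n -> 'I_m -> R) (c : R).

(** The quadratic form whose nonnegativity says that the matrix [a] contracts squared
norms by a factor at least [c]. *)
Definition form_excess (v : 'I_m -> R) : R :=
  \sum_i (\sum_j v j * a i j) ^+ 2 - c * \sum_j v j ^+ 2.

Lemma form_excess_step (v : 'I_m -> R) (k : 'I_m) (t : R) :
  form_excess (fun j => v j + (j == k)%:R * t) =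
  form_excess v + 2 * t * (\sum_i (\sum_j v j * a i j) * a i k - c * v k)
    + t ^+ 2 * (\sum_i a i k ^+ 2 - c).
Proof.
rewrite /form_excess.
have E1 i : \sum_j (v j + (j == k)%:R * t) * a i j = \sum_j v j * a i j + t * a i k.
  under eq_bigr do rewrite mulrDl.
  rewrite big_split/=; congr (_ + _); rewrite (bigD1 k)//= eqxx mul1r.
  by rewrite big1 ?addr0// => j /negbTE ->; rewrite !mul0r.
have E2 : \sum_j (v j + (j == k)%:R * t) ^+ 2 = \sum_j v j ^+ 2 + (2 * t * v k + t ^+ 2).
  rewrite (bigD1 k)//= [in RHS](bigD1 k)//= eqxx mul1r.
  rewrite (eq_bigr (fun j => v j ^+ 2)); last by move=> j /negbTE ->; rewrite mul0r addr0.
  by ring.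
rewrite E2 (eq_bigr _ (fun i _ => congr1 (fun y => y ^+ 2) (E1 i))).
have -> : \sum_i (\sum_j v j * a i j + t * a i k) ^+ 2 =
    \sum_i (\sum_j v j * a i j) ^+ 2 +
    (2 * t * (\sum_i (\sum_j v j * a i j) * a i k) + t ^+ 2 * \sum_i a i k ^+ 2).
  rewrite !mulr_sumr -!big_split/=; apply: eq_bigr => i _; ring.
by ring.
Qed.

(** Along one coordinate the form is a parabola. Rounding towards the side on which
its linear part decreases, an increase can only come from the quadratic part,
whose coefficient is at most the squared norm of the corresponding column. Thus
the total error is governed by the Frobenius norm of [a], and no a priori bound on
the operator norm is needed. *)
Lemma round_to_grid (g : R) (x : 'I_m -> R) (s : seq 'I_m) :
  0 < g -> 0 <= c -> uniq s ->
  exists v : 'I_m -> R, [/\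
    form_excess v <= form_excess x + g ^+ 2 * \sum_(k <- s) \sum_i a i k ^+ 2,
    forall j, j \in s -> exists2 z : int, v j = g * z%:~R & `|v j - x j| <= g &
    forall j, j \notin s -> v j = x j].
Proof.
move=> g0 c0; elim: s => [_|k s IH /= /andP[ks us]].
  by exists x; split=> //; rewrite big_nil mulr0 addr0.
have [v [vQ vs vx]] := IH us.
have [z0 [z1 z2]] : exists z : int, g * z%:~R <= x k /\ x k <= g * z%:~R + g.
  exists (Num.floor (x k / g)); have := floor_itv (x k / g).
  move=> /andP[h1 h2]; split.
    by rewrite mulrC -ler_pdivlMr.
  by rewrite -[X in _ + X]mulr1 -mulrDr mulrC -ler_pdivrMr// ltW// -intrD1.
pose L := \sum_i (\sum_j v j * a i j) * a i k - c * v k.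
have [z [t [tE tL t2 tg]]] : exists z t, [/\ x k + t = g * z%:~R, t * L <= 0,
    t ^+ 2 <= g ^+ 2 & `|t| <= g].
  have [L0|L0] := leP 0 L.
    exists z0, (g * z0%:~R - x k).
    have tg : `|g * z0%:~R - x k| <= g by rewrite ler0_norm; lra.
    split => //; [by rewrite addrC subrK| |].
      by rewrite mulr_le0_ge0//; lra.
    by rewrite -(real_normK (num_real _)) ler_sqr ?nnegrE// ltW.
  exists (z0 + 1), (g * z0%:~R + g - x k).
  have tg : `|g * z0%:~R + g - x k| <= g by rewrite ger0_norm; lra.
  split => //; [by rewrite intrD mulrDr mulr1 addrC subrK| |].
    by rewrite mulr_ge0_le0//; lra.
  by rewrite -(real_normK (num_real _)) ler_sqr ?nnegrE// ltW.
exists (fun j => v j + (j == k)%:R * t); split.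
- rewrite form_excess_step -/L big_cons.
  have S0 : 0 <= \sum_i a i k ^+ 2 by apply: sumr_ge0 => i _; exact: sqr_ge0.
  have : t ^+ 2 * (\sum_i a i k ^+ 2 - c) <= g ^+ 2 * \sum_i a i k ^+ 2.
    apply: (@le_trans _ _ (t ^+ 2 * \sum_i a i k ^+ 2)).
      by rewrite ler_wpM2l ?sqr_ge0//; lra.
    by rewrite ler_wpM2r.
  lra.
- move=> j; rewrite inE; have [-> _|jk /= js] := eqVneq j k.
    by exists z; rewrite mul1r vx// // addrC addKr.
  by rewrite mul0r addr0; exact: vs.
- move=> j; rewrite inE negb_or => /andP[/negbTE -> js].
  by rewrite mul0r addr0 vx.
Qed.

(** Nonnegativity on the vectors with integer coordinates, written as sign and
absolute value, and $\ell^1$ norm at most [N]. No normalization is needed because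
the form is homogeneous. *)
Definition net_nonneg (N : nat) : Prop :=
  forall (s : 'I_m -> bool) (t : 'I_m -> nat), (\sum_j t j <= N)%N ->
    0 <= form_excess (fun j => (-1) ^+ s j * (t j)%:R).

Lemma form_excess_scale g (w : 'I_m -> R) :
  form_excess (fun j => g * w j) = g ^+ 2 * form_excess w.
Proof.
rewrite /form_excess mulrBr; congr (_ - _).
  rewrite mulr_sumr; apply: eq_bigr => i _; rewrite -exprMn; congr (_ ^+ 2).
  by rewrite mulr_sumr; apply: eq_bigr => j _; rewrite mulrA.
rewrite mulrCA; congr (_ * _); rewrite mulr_sumr; apply: eq_bigr => j _.
by rewrite exprMn.
Qed.

(** Round [x] to the grid of mesh $h \|x\| / \sqrt m$. The rounded vector is a multiple
of an integer vector of $\ell^1$ norm at most $m (1/h + 1)$, where the form is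
nonnegative, and the rounding costs at most $h^2 C \|x\|^2$. *)
Lemma net_lower_bound (B : nat) (C h : R) : 0 <= c -> 0 < h -> h^-1 + 1 <= B%:R ->
  net_nonneg (m * B) -> \sum_i \sum_j a i j ^+ 2 <= C * m%:R ->
  forall x : 'I_m -> R,
    (c - h ^+ 2 * C) * \sum_j x j ^+ 2 <= \sum_i (\sum_j x j * a i j) ^+ 2.
Proof.
move=> c0 h0 hB net frob x.
set N := \sum_j x j ^+ 2.
have N0 : 0 <= N by apply: sumr_ge0 => j _; exact: sqr_ge0.
have [N00|Nn0] := eqVneq N 0.
  by rewrite N00 mulr0; apply: sumr_ge0 => i _; exact: sqr_ge0.
have {N0 Nn0}N0 : 0 < N by rewrite lt_def Nn0.
have m0 : (0 < m)%N.
  by case: (posnP m) => // m0; move: N0; rewrite /N big1 ?ltxx// => j; have := ltn_ord j; rewrite [X in (_ < X)%N -> _]m0.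
have mR0 : 0 < m%:R :> R by rewrite ltr0n.
pose b := Num.sqrt (N / m%:R).
have b2 : b ^+ 2 = N / m%:R by rewrite sqr_sqrtr// divr_ge0 ?ltW.
have b0 : 0 < b by rewrite sqrtr_gt0 divr_gt0.
(* The mesh is relative to the root mean square [b] of the coordinates of [x]. *)
pose g := h * b.
have g0 : 0 < g by exact: mulr_gt0.
have [v [vQ vz _]] := round_to_grid x g0 c0 (index_enum_uniq 'I_m).
have {}vz j : exists z : int, v j = g * z%:~R /\ `|v j - x j| <= g.
  by have [//|z] := vz j; [rewrite mem_index_enum|exists z].
have [z zP] := choice vz.
have vE : v = fun j => g * ((-1) ^+ (z j < 0)%R * (`|z j|%N)%:R).
  apply/funext => j; rewrite (zP j).1; congr (_ * _).
  by rewrite {1}[z j]intEsign rmorphM/= rmorph_sign.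
have zsum : (\sum_j `|z j| <= m * B)%N.
  rewrite -(ler_nat R) natr_sum natrM.
  apply: (@le_trans _ _ (\sum_j ((x j ^+ 2 / b ^+ 2 + 1) / (2 * h) + 1))).
    apply: ler_sum => j _.
    have E : (`|z j|%N)%:R = `|(z j)%:~R| :> R by rewrite natr_absz intr_norm.
    rewrite E -(ler_pM2l g0) -[X in X * `|_|](gtr0_norm g0) -normrM -(zP j).1.
    (* The $\ell^1$ norm is bounded by the $\ell^2$ norm through $2 |x_j| b \le x_j^2 + b^2$. *)
    have h1 : `|v j| <= `|x j| + g.
      by rewrite -[v j](subrK (x j)) (le_trans (ler_normD _ _))// addrC lerD2l (zP j).2.
    apply: le_trans h1 _; rewrite mulrDr mulr1 lerD2r.
    have -> : g * ((x j ^+ 2 / b ^+ 2 + 1) / (2 * h)) = (x j ^+ 2 + b ^+ 2) / (2 * b).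
      by rewrite /g; field; rewrite !gt_eqF.
    rewrite ler_pdivlMr ?mulr_gt0//.
    have : 0 <= (`|x j| - b) ^+ 2 by exact: sqr_ge0.
    by rewrite sqrrB real_normK ?num_real//; lra.
  rewrite big_split/= sumr_const card_ord -mulr_suml big_split/= sumr_const card_ord.
  rewrite -mulr_suml -/N b2.
  have -> : (N / (N / m%:R) + m%:R) / (2 * h) + m%:R = m%:R * (h^-1 + 1) :> R.
    by field; rewrite !gt_eqF.
  by rewrite ler_wpM2l// ltW.
have Qv : 0 <= form_excess v.
  by rewrite vE form_excess_scale mulr_ge0 ?sqr_ge0//; exact: net.
have := le_trans Qv vQ; rewrite exchange_big/= in frob *; rewrite /form_excess -/N.
have : g ^+ 2 * \sum_(k < m) \sum_i a i k ^+ 2 <= h ^+ 2 * C * N.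
  rewrite /g exprMn b2.
  have -> : h ^+ 2 * C * N = h ^+ 2 * (N / m%:R) * (C * m%:R).
    by field; rewrite gt_eqF.
  apply: ler_wpM2l => //; apply: mulr_ge0; first exact: sqr_ge0.
  by apply: divr_ge0; exact: ltW.
lra.
Qed.

End Net.

Section GramLowerBound.
Context {R : realType} {d : measure_display} {T : measurableType d}.
Variable (P : probability T R).

(** A finite type that codes the integer vectors of [net_nonneg], in a form whose
cardinality is known. *)
Definition net_index (m N : nat) : finType :=
  ({ffun 'I_m -> bool} *
   {t : m.-tuple 'I_N.+1 | t \in [set t : m.-tuple 'I_N.+1 | \sum_(i <- t) i <= N]%N%SET})%type.

Definition net_point (m N : nat) (k : net_index m N) (j : 'I_m) : R :=
  (-1) ^+ k.1 j * (tnth (val k.2) j)%:R.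

Lemma bin_le_exp2 (a b : nat) : ('C(a, b) <= 2 ^ a)%N.
Proof.
have [ab|ab] := leqP b a; last by rewrite bin_small.
rewrite -[2%N]/(1 + 1)%N expnDn.
rewrite (bigD1 (Ordinal (ab : b < a.+1)%N))//= !exp1n !muln1.
exact: leq_addr.
Qed.

Lemma card_net_index m N : (#|net_index m N| <= 2 ^ (2 * m + N))%N.
Proof.
rewrite card_prod card_ffun card_bool card_ord card_sig.
rewrite (eq_card (B := [set t : m.-tuple 'I_N.+1 | \sum_(i <- t) i <= N]%N%SET)); last first.
  by move=> t; rewrite inE.
rewrite card_partial_ord_partitions mul2n -addnn -addnA expnD leq_mul2l.
by rewrite bin_le_exp2 orbT.
Qed.

Lemma net_nonneg_points n m (a : 'I_n -> 'I_m -> R) c N :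
  (forall k : net_index m N, 0 <= form_excess a c (net_point k)) ->
  net_nonneg a c N.
Proof.
move=> H s t tN.
have tj j : (t j < N.+1)%N.
  by rewrite ltnS (leq_trans _ tN)// (bigD1 j)//= leq_addr.
pose t' : m.-tuple 'I_N.+1 := [tuple Ordinal (tj j) | j < m].
have t'N : t' \in [set t : m.-tuple 'I_N.+1 | \sum_(i <- t) i <= N]%N%SET.
  rewrite inE big_tuple (eq_bigr t)// => j _.
  by rewrite tnth_mktuple.
have := H ([ffun j => s j], exist _ t' t'N); congr (_ <= form_excess _ _ _).
by apply/funext => j; rewrite /net_point /= ffunE tnth_mktuple.
Qed.

(** The $2^{m (B + 2)}$ lattice points are controlled by a union bound, and the
Frobenius norm by Markov's inequality. The exceptional set is given by its
existence only, because the conclusion involves all vectors and is not obviously a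
measurable event. *)
Lemma gram_lower_bound (n m p : nat) (X : 'I_n * 'I_p -> {RV P >-> R})
    (f : 'I_m -> 'I_p) (z C h : R) (B : nat) :
  (0 < n)%N -> (0 < m)%N -> mutually_independent X ->
  (forall i, has_gaussian_mgf P (1 / n%:R) (X i)) -> injective f ->
  0 < z <= 1 -> 0 < C -> 0 < h -> h ^+ 2 * C <= z -> h^-1 + 1 <= B%:R ->
  exists E : set T, [/\ measurable E,
    (P E <= (8 / C + (2 ^ (m * (B + 2)))%:R * expR (- (z ^+ 2 / 1280 * n%:R)))%:E)%E &
    forall x, ~ E x -> forall v : 'I_m -> R,
      (1 - 2 * z) * \sum_j v j ^+ 2 <= \sum_i (\sum_j v j * X (i, f j) x) ^+ 2].
Proof.
move=> n0 m0 ind hX fI z01 C0 h0 hC hB.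
have /andP[z0 z1] := z01.
pose a x i j := X (i, f j) x.
pose E1 := [set x | C * m%:R < \sum_i \sum_j X (i, f j) x ^+ 2].
have mE1 : measurable E1.
  apply: measurable_set_lt => //; apply: measurable_sum => i.
  by apply: measurable_sum => j; exact: measurable_funX.
pose Q (k : net_index m (m * B)) := [set x |
  \sum_i (\sum_j net_point k j * X (i, f j) x) ^+ 2 < (1 - z) * \sum_j net_point k j ^+ 2].
have mQ k : measurable (Q k).
  apply: measurable_set_lt => //; apply: measurable_sum => i; apply: measurable_funX.
  by apply: measurable_sum => j; exact: measurable_funM.
pose E2 := [set x | exists k, Q k x].
have mE2 : measurable E2 by exact: union_bound_measurable.
exists (E1 `|` E2); split; first exact: measurableU.
  apply: (@le_trans _ _ (P E1 + P E2)%E); first exact: measureU2.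
  rewrite EFinD; apply: leeD.
    exact: frobenius_tail.
  apply: le_trans (union_bound_const mQ (fun k =>
    gaussian_image_lower_tail (net_point k) n0 ind hX fI z01)) _.
  rewrite lee_fin ler_wpM2r ?expR_ge0// ler_nat.
  by apply: leq_trans (card_net_index _ _) _; rewrite leq_exp2l//; lia.
move=> x nE v.
have Q0 (k : net_index m (m * B)) : 0 <= form_excess (a x) (1 - z) (net_point k).
  rewrite subr_ge0 leNgt; apply/negP => Qk; apply: nE; right; by exists k.
have frob : \sum_i \sum_j a x i j ^+ 2 <= C * m%:R.
  by rewrite leNgt; apply/negP => Ex; apply: nE; left.
have c0 : 0 <= 1 - z by lra.
apply: le_trans (net_lower_bound c0 h0 hB (net_nonneg_points Q0) frob v).
apply: ler_wpM2r; first by apply: sumr_ge0 => j _; exact: sqr_ge0.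
lra.
Qed.

End GramLowerBound.

(** * Optimality conditions of the Lasso *)

Section InnerProduct.
Context {R : realType}.

Definition dot n (u v : 'cV[R]_n) : R := \sum_i u i 0 * v i 0.

Lemma dotC n (u v : 'cV[R]_n) : dot u v = dot v u.
Proof. by apply: eq_bigr => i _; rewrite mulrC. Qed.

Lemma dotDl n (u v w : 'cV[R]_n) : dot (u + v) w = dot u w + dot v w.
Proof. by rewrite -big_split; apply: eq_bigr => i _; rewrite /= mxE mulrDl. Qed.

Lemma dotZl n c (u w : 'cV[R]_n) : dot (c *: u) w = c * dot u w.
Proof. by rewrite mulr_sumr; apply: eq_bigr => i _; rewrite mxE mulrA. Qed.

Lemma dotDr n (u v w : 'cV[R]_n) : dot w (u + v) = dot w u + dot w v.
Proof. by rewrite dotC dotDl !(dotC w). Qed.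

Lemma dotZr n c (u w : 'cV[R]_n) : dot w (c *: u) = c * dot w u.
Proof. by rewrite dotC dotZl dotC. Qed.

Lemma dotNl n (u w : 'cV[R]_n) : dot (- u) w = - dot u w.
Proof. by rewrite -scaleN1r dotZl mulN1r. Qed.

Lemma dotNr n (u w : 'cV[R]_n) : dot w (- u) = - dot w u.
Proof. by rewrite dotC dotNl dotC. Qed.

Lemma dot_sqrB n (u v : 'cV[R]_n) :
  dot (u - v) (u - v) = dot u u - 2 * dot v u + dot v v.
Proof. rewrite !(dotDl, dotDr, dotNl, dotNr) (dotC u v); ring. Qed.

Lemma dot_mulmx n m (A : 'M[R]_(n, m)) (u : 'cV[R]_m) (v : 'cV[R]_n) :
  dot (A *m u) v = dot u (A^T *m v).
Proof.
rewrite /dot; under eq_bigr do rewrite mxE mulr_suml.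
rewrite exchange_big; apply: eq_bigr => j _; rewrite mxE mulr_sumr.
by apply: eq_bigr => i _; rewrite mxE; ring.
Qed.

Lemma dot_ge0 n (u : 'cV[R]_n) : 0 <= dot u u.
Proof. by apply: sumr_ge0 => i _; rewrite -expr2 sqr_ge0. Qed.

Lemma sqr_coord_le_dot n (u : 'cV[R]_n) i : u i 0 ^+ 2 <= dot u u.
Proof.
rewrite /dot (bigD1 i)//= -expr2 lerDl; apply: sumr_ge0 => j _.
by rewrite -expr2 sqr_ge0.
Qed.

Lemma dot_eq0 n (u : 'cV[R]_n) : dot u u = 0 -> u = 0.
Proof.
move=> u0; apply/matrixP => i j; rewrite ord1 mxE; apply/eqP.
by rewrite -sqrf_eq0 eq_le sqr_ge0 andbT -u0 sqr_coord_le_dot.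
Qed.

Lemma cauchy_schwarz n (u v : 'cV[R]_n) : dot u v ^+ 2 <= dot u u * dot v v.
Proof.
have [v0|vn0] := eqVneq (dot v v) 0.
  rewrite (dot_eq0 v0) (_ : dot u 0 = 0) ?expr0n ?mulr_ge0 ?dot_ge0//.
  by rewrite /dot big1// => i _; rewrite mxE mulr0.
have vp : 0 < dot v v by rewrite lt_def vn0 dot_ge0.
have := dot_ge0 (dot v v *: u - dot u v *: v).
have -> : dot (dot v v *: u - dot u v *: v) (dot v v *: u - dot u v *: v) =
    dot v v * (dot u u * dot v v - dot u v ^+ 2).
  rewrite !(dotDl, dotDr, dotNl, dotNr, dotZl, dotZr) (dotC v u); ring.
by rewrite pmulr_rge0// subr_ge0.
Qed.

End InnerProduct.

Section LassoKKT.
Context {R : realType}.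

Lemma lasso_objectiveE n p (X : 'M[R]_(n, p)) (y : 'cV[R]_n) (lambda : R) b :
  lasso_objective X y lambda b =
  2^-1 * dot (y - X *m b) (y - X *m b) + lambda * \sum_j `|b j 0|.
Proof. by rewrite /lasso_objective /dot. Qed.

(** Expanding the objective around [b], the difference is half the squared norm of
$X (b' - b)$ plus a sum of nonnegative terms, one for each coordinate. At a
minimizer all of them vanish; strict dual feasibility then forces $b'$ to vanish
where [b] does, and injectivity of [X] on such vectors concludes. *)
Lemma lasso_strict_dual_unique n p (X : 'M[R]_(n, p)) (y : 'cV[R]_n) (lambda : R)
    (b b' : 'cV[R]_p) :
  0 < lambda ->
  (forall j, b j 0 = 0 -> `|(X^T *m (y - X *m b)) j 0| < lambda) ->
  (forall j, b j 0 != 0 -> (X^T *m (y - X *m b)) j 0 = lambda * Num.sg (b j 0)) ->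
  (forall v : 'cV[R]_p, (forall j, b j 0 = 0 -> v j 0 = 0) -> X *m v = 0 -> v = 0) ->
  is_lasso_estimate X y lambda b' -> b' = b.
Proof.
move=> l0 kkt0 kkt1 inj /(_ b); rewrite !lasso_objectiveE.
set rho := y - X *m b; set D := b' - b.
have -> : y - X *m b' = rho - X *m D by rewrite /D mulmxBr /rho opprB addrA subrK.
rewrite dot_sqrB (dot_mulmx _ _ rho).
(* The contribution of coordinate [j] to the increase of the objective. *)
pose h j := lambda * `|b' j 0| - lambda * `|b j 0| - D j 0 * (X^T *m rho) j 0.
have h0 j : 0 <= h j /\ (b j 0 = 0 -> h j = 0 -> b' j 0 = 0).
  have := kkt0 j; have := kkt1 j; rewrite -/rho /h; set g := (X^T *m rho) j 0.
  have -> : D j 0 = b' j 0 - b j 0 by rewrite !mxE.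
  have [->|bn0] := eqVneq (b j 0) 0.
    move=> _ /(_ erefl); rewrite normr0 mulr0 !subr0 => gl.
    have hle : b' j 0 * g <= `|b' j 0| * `|g| by rewrite -normrM ler_norm.
    have hb : 0 <= `|b' j 0| * (lambda - `|g|) by rewrite mulr_ge0// subr_ge0 ltW.
    split; first by lra.
    move=> _ E; have : `|b' j 0| * (lambda - `|g|) = 0 by lra.
    move=> /eqP; rewrite mulf_eq0 normr_eq0 => /orP[/eqP//|].
    by rewrite subr_eq0 gt_eqF.
  move=> /(_ isT) -> _; split; last by move=> b0; rewrite b0 eqxx in bn0.
  have -> : lambda * `|b' j 0| - lambda * `|b j 0| - (b' j 0 - b j 0) * (lambda * Num.sg (b j 0))
    = lambda * (`|b' j 0| - b' j 0 * Num.sg (b j 0))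
      + lambda * (b j 0 * Num.sg (b j 0) - `|b j 0|) by ring.
  rewrite [b j 0 * _]mulrC -normrEsg subrr mulr0 addr0 mulr_ge0 ?(ltW l0)// subr_ge0.
  by rewrite (le_trans (ler_norm _))// normrM normr_sg bn0 mulr1.
move=> opt.
have sumh : \sum_j h j = lambda * (\sum_j `|b' j 0|) - lambda * (\sum_j `|b j 0|)
    - dot D (X^T *m rho).
  by rewrite /h /dot !mulr_sumr -!sumrB.
have XD0 := dot_ge0 (X *m D).
have sh0 : 0 <= \sum_j h j by apply: sumr_ge0 => j _; exact: (h0 j).1.
have {}sh0 : \sum_j h j = 0 by lra.
have {}XD0 : dot (X *m D) (X *m D) = 0 by lra.
have hj j : h j = 0 by apply: (psumr_eq0P (fun i _ => (h0 i).1) sh0).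
suff : D = 0 by move/eqP; rewrite subr_eq0 => /eqP.
apply: inj; last exact: dot_eq0.
by move=> j bj; rewrite !mxE bj subr0; apply: (h0 j).2.
Qed.

End LassoKKT.

Section GramDual.
Context {R : realType}.
Variables (n m : nat) (A : 'M[R]_(n, m)) (c : R).
Hypothesis c0 : 0 < c.
Hypothesis Ac : forall v, c * dot v v <= dot (A *m v) (A *m v).

(** The solution of $B^T B q = 1$, by Cramer's rule: unlike a formula that tests
invertibility, it is visibly a measurable function of the entries. *)
Definition gram_solve (k l : nat) (B : 'M[R]_(k, l)) : 'cV[R]_l :=
  (\det (B^T *m B))^-1 *: (\adj (B^T *m B) *m const_mx 1).

(** The vector $u = X_S G^{-1} 1$: with all signs positive, the Lasso residual is
$\lambda u$ up to a projection of the noise. *)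
Definition gram_dual (k l : nat) (B : 'M[R]_(k, l)) : 'cV[R]_k :=
  B *m gram_solve B.

Lemma gram_unit : A^T *m A \in unitmx.
Proof.
rewrite -row_free_unit -kermx_eq0; apply/rowV0P => v /sub_kermxP vG.
have Av : dot (A *m v^T) (A *m v^T) = 0.
  rewrite dot_mulmx mulmxA -[A^T *m A]trmxK trmx_mul trmxK -trmx_mul vG.
  by rewrite trmx0 /dot big1// => i _; rewrite !mxE mulr0.
have vv : dot v^T v^T = 0.
  have := Ac v^T; rewrite Av => h; have := dot_ge0 v^T.
  by rewrite le_eqVlt => /orP[/eqP//|h2]; have : 0 < c * dot v^T v^T by [exact: mulr_gt0]; lra.
by rewrite -[v]trmxK (dot_eq0 vv) trmx0.
Qed.

Lemma gram_solveP : A^T *m A *m gram_solve A = const_mx 1.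
Proof.
rewrite /gram_solve -scalemxAr mulmxA mul_mx_adj mul_scalar_mx scalerA mulVf ?scale1r//.
by rewrite -unitfE -unitmxE gram_unit.
Qed.

Lemma gram_dual_sqr_sum : dot (gram_dual A) (gram_dual A) = \sum_j gram_solve A j 0.
Proof.
rewrite /gram_dual dot_mulmx mulmxA gram_solveP /dot.
by apply: eq_bigr => j _; rewrite [X in _ * X]mxE mulr1.
Qed.

(** Inequality of arithmetic and geometric means in each coordinate; it plays the role
of the Cauchy-Schwarz inequality without square roots. *)
Lemma gram_solve_sum_le :
  \sum_j gram_solve A j 0 <= (c * dot (gram_solve A) (gram_solve A) + m%:R / c) / 2.
Proof.
have -> : m%:R / c = \sum_(j < m) c^-1 by rewrite sumr_const card_ord -[RHS]mulr_natl.
rewrite /dot mulr_sumr -big_split /= mulr_suml; apply: ler_sum => j _.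
set q := gram_solve A j 0.
have : 0 <= (c * q - 1) ^+ 2 / c by apply: divr_ge0; [exact: sqr_ge0|exact: ltW].
have -> : (c * q - 1) ^+ 2 / c = c * (q * q) + c^-1 - 2 * q by field; rewrite gt_eqF.
lra.
Qed.

(** Follows from $c \|q\|^2 \le \|A q\|^2 = 1^T q$ and [gram_solve_sum_le]. *)
Lemma gram_solve_norm : dot (gram_solve A) (gram_solve A) <= m%:R / c ^+ 2.
Proof.
have := Ac (gram_solve A); rewrite -/(gram_dual A) gram_dual_sqr_sum => h.
have h2 := gram_solve_sum_le.
rewrite -(ler_pM2l c0); have -> : c * (m%:R / c ^+ 2) = m%:R / c by field; rewrite gt_eqF.
lra.
Qed.

Lemma gram_dual_norm : dot (gram_dual A) (gram_dual A) <= m%:R / c.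
Proof.
have := Ac (gram_solve A); rewrite -/(gram_dual A) gram_dual_sqr_sum => h.
by have := gram_solve_sum_le; lra.
Qed.

(** Least squares fit of [r] on the columns of [A]; both bounds follow from
Pythagoras' identity. *)
Lemma least_squares_norms (r : 'cV[R]_n) :
  exists a : 'cV[R]_m, [/\ A^T *m (r - A *m a) = 0,
    dot (r - A *m a) (r - A *m a) <= dot r r & c * dot a a <= dot r r].
Proof.
exists (invmx (A^T *m A) *m (A^T *m r)); set a := invmx _ *m _.
have orth : A^T *m (r - A *m a) = 0.
  by rewrite mulmxBr mulmxA /a mulKVmx ?gram_unit// subrr.
have pyth : dot r r = dot (r - A *m a) (r - A *m a) + dot (A *m a) (A *m a).
  have : dot (A *m a) (r - A *m a) = 0.
    by rewrite dot_mulmx orth /dot big1// => i _; rewrite [X in _ * X]mxE mulr0.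
  by rewrite dot_sqrB dotDr dotNr; lra.
split=> //; first by rewrite pyth lerDl dot_ge0.
by apply: le_trans (Ac a) _; rewrite pyth lerDr dot_ge0.
Qed.

End GramDual.

Section Selection.
Context {R : realType}.

Lemma sqr_le_abs (x y : R) : 0 <= y -> x ^+ 2 <= y ^+ 2 -> `|x| <= y.
Proof.
by move=> y0; rewrite -(real_normK (num_real x)) ler_sqr ?nnegrE.
Qed.

(** The minimizer is the vector supported on the range of [f] with entries
$b_S + a - \lambda q$, where [a] is the least squares fit of [r] and $q = G^{-1} 1$.
The bound on [bS] keeps these entries positive, so that their signs agree with the
vector $1$ in the definition of [q]; outside the range of [f], the margin [z] left
by the dual vector [u] absorbs the correlation with the residual of the fit. *)
Lemma lasso_selects_exactly n m p (X : 'M[R]_(n, p)) (f : 'I_m -> 'I_p)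
    (bS : 'cV[R]_m) (r : 'cV[R]_n) (lambda c z D2 R2 : R) (b' : 'cV[R]_p) :
  let A := colsub f X in
  injective f -> 0 < c -> 0 < lambda -> 0 < z ->
  (forall v, c * dot v v <= dot (A *m v) (A *m v)) ->
  (forall j, j \notin codom f -> `|dot (gram_dual A) (col j X)| <= 1 - z) ->
  (forall j, dot (col j X) (col j X) <= D2) -> dot r r <= R2 ->
  0 <= D2 -> D2 * R2 < (z * lambda) ^+ 2 ->
  (forall i, lambda * Num.sqrt (m%:R / c ^+ 2) + Num.sqrt (R2 / c) < bS i 0) ->
  is_lasso_estimate X (A *m bS + r) lambda b' ->
  forall j, (b' j 0 != 0) = (j \in codom f).
Proof.
move=> A fI c0 l0 z0 Ac hu hX hr D20 hDR hb est.
have R20 : 0 <= R2 := le_trans (dot_ge0 r) hr.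
have [a [orth resid anorm]] := least_squares_norms c0 Ac r.
have [q qE] : exists q, q = gram_solve A by exists (gram_solve A).
have uE : gram_dual A = A *m q by rewrite qE.
pose w := bS + a - lambda *: q.
pose b : 'cV[R]_p := (\matrix_(j < p, i < m) (j == f i)%:R) *m w.
have XE : X *m (\matrix_(j < p, i < m) (j == f i)%:R) = A.
  apply/matrixP => i j; rewrite !mxE (bigD1 (f j))//= !mxE eqxx mulr1 big1 ?addr0//.
  by move=> k /negbTE kf; rewrite mxE kf mulr0.
have bf i : b (f i) 0 = w i 0.
  rewrite mxE (bigD1 i)//= [X in X * _ + _]mxE eqxx mul1r big1 ?addr0// => k ki.
  by rewrite mxE (inj_eq fI) eq_sym (negbTE ki) mul0r.
have bN j : j \notin codom f -> b j 0 = 0.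
  move=> jf; rewrite mxE big1// => i _; rewrite mxE.
  by case: eqP => [jE|]; rewrite ?mul0r//; move: jf; rewrite jE codom_f.
have w0 i : 0 < w i 0.
  have q2 : `|q i 0| <= Num.sqrt (m%:R / c ^+ 2).
    apply: sqr_le_abs; first exact: sqrtr_ge0.
    rewrite sqr_sqrtr ?divr_ge0 ?sqr_ge0//.
    by rewrite qE; exact: le_trans (sqr_coord_le_dot _ _) (gram_solve_norm c0 Ac).
  have a2 : `|a i 0| <= Num.sqrt (R2 / c).
    apply: sqr_le_abs; first exact: sqrtr_ge0.
    rewrite sqr_sqrtr ?(divr_ge0 R20 (ltW c0))//.
    apply: le_trans (sqr_coord_le_dot _ _) _; rewrite ler_pdivlMr// mulrC.
    exact: le_trans anorm hr.
  rewrite !mxE; have := hb i.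
  have := ler_norm (q i 0); have := lerNnormlW (lexx `|a i 0|) => ha hq hbi.
  have : lambda * q i 0 <= lambda * Num.sqrt (m%:R / c ^+ 2).
    by apply: ler_wpM2l; [exact: ltW|exact: le_trans hq q2].
  lra.
have rhoE : A *m bS + r - X *m b = (r - A *m a) + lambda *: gram_dual A.
  rewrite /b mulmxA XE /w mulmxBr mulmxDr -scalemxAr -uE.
  by move: (A *m bS) (A *m a) (gram_dual A) => x1 x2 x3; apply/matrixP => i j; rewrite !mxE; ring.
have colE j : (X^T *m (A *m bS + r - X *m b)) j 0 =
    dot (r - A *m a) (col j X) + lambda * dot (gram_dual A) (col j X).
  rewrite rhoE; move: (r - A *m a) (gram_dual A) => x1 x2.
  rewrite mulmxDr -scalemxAr mxE [X in _ + X]mxE.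
  by congr (_ + _ * _); rewrite mxE; apply: eq_bigr => i _; rewrite !mxE mulrC.
(* On the range of [f] the correlations of the columns with the residual are exactly
$\lambda$. *)
have colf i : dot (r - A *m a) (col (f i) X) + lambda * dot (gram_dual A) (col (f i) X) = lambda.
  have dA v : dot v (col (f i) X) = (A^T *m v) i 0.
    by rewrite mxE; apply: eq_bigr => k _; rewrite !mxE mulrC.
  by rewrite !dA orth /gram_dual mulmxA (gram_solveP c0 Ac) mxE [X in _ * X]mxE add0r mulr1.
have b'b : b' = b.
  apply: (lasso_strict_dual_unique l0 _ _ _ est).
  - move=> j bj; rewrite colE.
    have jf : j \notin codom f.
      by apply/negP => /codomP[i jE]; have := w0 i; rewrite -bf -jE bj ltxx.
    have h1 : `|dot (r - A *m a) (col j X)| < z * lambda.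
      have zl : 0 < z * lambda by exact: mulr_gt0.
      rewrite ltNge; apply/negP => h.
      have : (z * lambda) ^+ 2 <= dot (r - A *m a) (col j X) ^+ 2.
        by rewrite -[leRHS](real_normK (num_real _)) ler_sqr ?nnegrE// ltW.
      rewrite leNgt => /negP; apply; apply: le_lt_trans (cauchy_schwarz _ _) _.
      apply: le_lt_trans hDR; rewrite mulrC.
      by apply: ler_pM; rewrite ?dot_ge0// (le_trans resid).
    apply: le_lt_trans (ler_normD _ _) _; rewrite normrM (gtr0_norm l0).
    have := ler_wpM2l (ltW l0) (hu j jf); lra.
  - move=> j bj; rewrite colE.
    have [|jf] := boolP (j \in codom f); last by rewrite bN// eqxx in bj.
    by move=> /codomP[i ->]; rewrite colf bf gtr0_sg// mulr1.
  - move=> v vb Xv.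
    pose vS : 'cV[R]_m := \col_i v (f i) 0.
    have vE : v = (\matrix_(j < p, i < m) (j == f i)%:R) *m vS.
      apply/matrixP => j k; rewrite ord1 mxE.
      have [/codomP[i ->]|jf] := boolP (j \in codom f).
        rewrite (bigD1 i)//= !mxE eqxx mul1r big1 ?addr0// => l li.
        by rewrite !mxE (inj_eq fI) eq_sym (negbTE li) mul0r.
      rewrite vb ?bN// big1// => i _; rewrite mxE.
      by case: eqP => [jE|]; rewrite ?mul0r//; move: jf; rewrite jE codom_f.
    have AvS : A *m vS = 0 by rewrite -XE -mulmxA -vE.
    have : vS = 0.
      apply: dot_eq0; apply/eqP; rewrite eq_le dot_ge0 andbT -(ler_pM2l c0) mulr0.
      apply: le_trans (Ac vS) _; rewrite AvS /dot big1// => i _.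
      by rewrite mxE mul0r.
    by rewrite vE => ->; rewrite mulmx0.
move=> j; rewrite b'b; have [/codomP[i ->]|jf] := boolP (j \in codom f).
  by rewrite bf gt_eqF.
by rewrite bN// eqxx.
Qed.

End Selection.

(** * Measurability of the dual direction *)

Section MeasurableMatrices.
Context {R : realType} {d : measure_display} {T : measurableType d}.

Lemma measurable_det m (A : T -> 'M[R]_m) :
  (forall i j, measurable_fun setT (fun x => A x i j)) ->
  measurable_fun setT (fun x => \det (A x)).
Proof.
move=> mA; apply: measurable_sum => s; apply: measurable_funM => //.
by apply: measurable_prod => i _; exact: mA.
Qed.

Lemma measurable_adj m (A : T -> 'M[R]_m) i j :
  (forall i j, measurable_fun setT (fun x => A x i j)) ->
  measurable_fun setT (fun x => (\adj (A x)) i j).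
Proof.
move=> mA; under eq_fun do rewrite mxE /cofactor.
apply: measurable_funM => //; apply: measurable_det => k l.
by under eq_fun do rewrite !mxE; exact: mA.
Qed.

End MeasurableMatrices.


Section MeasurableGramDual.
Context {R : realType} {d : measure_display} {T : measurableType d}.

(** The inverse is not continuous at $0$, but $y^{-1} = y\, e^{- \ln y^2}$ holds
everywhere, with the convention $0^{-1} = 0$. *)
Lemma measurable_fun_inv (g : T -> R) :
  measurable_fun setT g -> measurable_fun setT (fun x => (g x)^-1).
Proof.
move=> mg.
have -> : (fun x => (g x)^-1) = fun x => g x * expR (- ln (g x ^+ 2)).
  apply/funext => x; have [->|gx] := eqVneq (g x) 0; first by rewrite invr0 mul0r.
  have g2 : 0 < g x ^+ 2 by rewrite exprn_even_gt0.
  by rewrite expRN lnK ?posrE//; field.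
apply: measurable_funM => //; apply: measurableT_comp => //.
apply: measurableT_comp => //; apply: measurableT_comp; first exact: measurable_ln.
exact: measurable_funX.
Qed.

Lemma measurable_gram_dual n m (A : T -> 'M[R]_(n, m)) i :
  (forall i j, measurable_fun setT (fun x => A x i j)) ->
  measurable_fun setT (fun x => gram_dual (A x) i 0).
Proof.
move=> mA.
have mG j l : measurable_fun setT (fun x => ((A x)^T *m A x) j l).
  under eq_fun do rewrite mxE; apply: measurable_sum => k.
  by apply: measurable_funM => //; under eq_fun do rewrite mxE; exact: mA.
under eq_fun do rewrite mxE; apply: measurable_sum => j.
apply: measurable_funM => //; under eq_fun do rewrite mxE.
apply: measurable_funM; first by apply: measurable_fun_inv; exact: measurable_det.
under eq_fun do rewrite mxE; apply: measurable_sum => l.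
apply: measurable_funM; first exact: measurable_adj.
exact: measurable_cst.
Qed.

End MeasurableGramDual.


(** * Recovery of the largest coefficients for a fixed problem *)

Section GeometricTail.
Context {R : realType}.

Lemma geometric_partial_sum_le (M : R) (m k e : nat) : 2 <= M -> (m + e < k)%N ->
  \sum_(m <= j < (m + e).+1) M ^+ (k - j) <= 2 * M ^+ (k - m) - M ^+ (k - m - e).
Proof.
move=> M2; elim: e => [|e IH] mk.
  by rewrite addn0 big_nat1 subn0; lra.
rewrite addnS big_nat_recr/=; last by rewrite leqW// leq_addr.
have mk' : (m + e < k)%N by lia.
have {}IH := IH mk'.
have [i kE] : exists i, (k - m - e = i.+1)%N by exists (k - m - e).-1; lia.
have -> : (k - (m + e).+1 = i)%N by lia.
have -> : (k - m - e.+1 = i)%N by lia.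
rewrite kE exprS in IH.
have : 2 * M ^+ i <= M * M ^+ i by rewrite ler_wpM2r// exprn_ge0//; lra.
lra.
Qed.

Lemma geometric_tail_le (M : R) (m k p : nat) : 2 <= M -> (m < k <= p)%N ->
  \sum_(j < p | (m <= j)%N) (if (j < k)%N then M ^+ (k - j) else 0) <= 2 * M ^+ (k - m).
Proof.
move=> M2 /andP[mk kp].
rewrite -(big_geq_mkord _ _ xpredT (fun j => if (j < k)%N then M ^+ (k - j) else 0)).
rewrite (big_cat_nat (n := k))//=; last exact: ltnW.
rewrite [X in _ + X]big_nat_cond [X in _ + X]big1 ?addr0; last first.
  by move=> j /andP[/andP[kj _] _]; rewrite ltnNge kj.
rewrite big_nat_cond (eq_bigr (fun j => M ^+ (k - j))); last first.
  by move=> j /andP[/andP[_ ->] _].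
rewrite -big_nat_cond.
have := geometric_partial_sum_le (m := m) (k := k) (e := (k - m).-1) M2.
have -> : (m + (k - m).-1).+1 = k by lia.
rewrite leqnn => /(_ isT) h; apply: le_trans h _; rewrite lerBlDr lerDl exprn_ge0//; lra.
Qed.

End GeometricTail.

Section GoodDesign.
Context {R : realType}.

(** Deterministic part: on the good event the residual has entries at most $3 s Q$ with
$s = \sqrt{6 L / n}$ and $Q = M^{k-m}$, since the geometric tail of the
coefficients is at most $2 Q$ and the noise is at most $n \le s Q$. So its squared
norm is at most $54 L Q^2$, the columns have squared norm at most $6 L$, and their
product $324 L^2 Q^2 = (18 L Q)^2$ explains the constant $19$ in the penalty. *)
Lemma recovery_of_good_design (n p k m : nat) (mp : (m <= p)%N) (X : 'M[R]_(n, p))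
    (zv : 'cV[R]_n) (M L e : R) (b' : 'cV[R]_p) :
  let A := colsub (widen_ord mp) X in
  (0 < n)%N -> (m <= n)%N -> (m + 4 <= k <= p)%N -> 1 <= L -> 0 < e <= 16^-1 ->
  50 * L * Num.sqrt n%:R / e <= M ->
  (forall v, (1 - 2 * e) * dot v v <= dot (A *m v) (A *m v)) ->
  (forall j : 'I_p, (m <= j)%N -> `|dot (gram_dual A) (col j X)| <= 1 - e) ->
  (forall i j, `|X i j| <= Num.sqrt (6 * L / n%:R)) ->
  (forall i, `|zv i 0| <= n%:R) ->
  is_lasso_estimate X (X *m beta_coef p k M + zv) (19 * L / e * M ^+ (k - m)) b' ->
  forall j, (b' j 0 != 0) = (j < m)%N.
Proof.
move=> A n0 mn /andP[mk kp] L1 /andP[e0 e1] hM Ac hu hX hz est.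
have n1 : 1 <= n%:R :> R by rewrite ler1n.
have nR0 : 0 < n%:R :> R by rewrite ltr0n.
pose N := Num.sqrt n%:R : R.
have N2 : N ^+ 2 = n%:R by rewrite sqr_sqrtr// ltW.
have N1 : 1 <= N by rewrite -sqrtr1 ler_wsqrtr.
have LN1 : L <= L * N by rewrite ler_peMr//; lra.
have LN2 : N <= L * N by rewrite ler_peMl//; lra.
have hMe : 50 * (L * N) <= M * e by rewrite -ler_pdivrMr// mulrA.
have M0 : 0 <= M.
  have : 0 < M * e by lra.
  by rewrite pmulr_lgt0// => /ltW.
have hM2 : 50 * (L * N) <= M.
  by apply: le_trans hMe _; rewrite ler_piMr//; lra.
pose Q := M ^+ (k - m).
have Q0 : 0 < Q by apply: exprn_gt0; lra.
have nQ : n%:R ^+ 2 <= Q.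
  apply: (@le_trans _ _ (M ^+ 4)).
    have -> : n%:R ^+ 2 = N ^+ 4 :> R by rewrite -N2 -exprM.
    by rewrite lerXn2r ?nnegrE//; lra.
  by apply: ler_weXn2l; [lra|by move: mk; clear; lia].
pose s := Num.sqrt (6 * L / n%:R).
have s2 : s ^+ 2 = 6 * L / n%:R by rewrite sqr_sqrtr// divr_ge0//; lra.
have s0 : 0 <= s by exact: sqrtr_ge0.
have ns1 : 1 <= n%:R * s.
  rewrite -(@ler_sqr _ 1) ?nnegrE ?mulr_ge0// expr1n exprMn s2.
  have -> : n%:R ^+ 2 * (6 * L / n%:R) = n%:R * (6 * L) by field; rewrite gt_eqF.
  by have : n%:R <= n%:R * (6 * L) by [rewrite ler_peMr//; lra]; lra.
have nsQ : n%:R <= s * Q.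
  apply: (@le_trans _ _ (s * n%:R ^+ 2)); last by rewrite ler_wpM2l.
  by rewrite expr2 mulrA [s * _]mulrC ler_peMl// ltW.
(* The coefficients beyond the first [m] are counted as noise. *)
pose bS : 'cV[R]_m := \col_l M ^+ (k - l).
pose r := X *m beta_coef p k M + zv - A *m bS.
have rE i : r i 0 = \sum_(j < p | (m <= j)%N) X i j * beta_coef p k M j 0 + zv i 0.
  rewrite mxE [X in X + _]mxE [X in _ + X]mxE [X in X + _ - _]mxE [X in _ - X]mxE.
  rewrite (bigID (fun j : 'I_p => (j < m)%N))/= big_ord_narrow/=.
  rewrite (eq_bigr (fun l => A i l * bS l 0)); last first.
    move=> l _; rewrite !mxE/=; congr (_ * _).
    have lk : (l < k)%N by rewrite (leq_trans (ltn_ord l))// (leq_trans _ mk)// leq_addr.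
    by rewrite lk.
  under [X in _ + X + _ - _]eq_bigl => j do rewrite -leqNgt.
  by ring.
have rb i : `|r i 0| <= 3 * s * Q.
  rewrite rE; apply: le_trans (ler_normD _ _) _.
  have h1 : `|\sum_(j < p | (m <= j)%N) X i j * beta_coef p k M j 0| <= s * (2 * Q).
    apply: le_trans (ler_norm_sum _ _ _) _.
    apply: (@le_trans _ _ (s * \sum_(j < p | (m <= j)%N)
      (if (j < k)%N then M ^+ (k - j) else 0))).
      rewrite mulr_sumr; apply: ler_sum => j _; rewrite normrM; apply: ler_pM => //.
      by rewrite mxE; case: ifP; rewrite ?normr0// ger0_norm// exprn_ge0.
    apply: ler_wpM2l => //; apply: geometric_tail_le; [lra|].
    by rewrite kp andbT (leq_trans _ mk)// addn4 !ltnS leqW// leqW// leqW.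
  have := hz i; lra.
have sumsq q (v : 'cV[R]_n) : 0 <= q -> (forall i, `|v i 0| <= q) ->
    dot v v <= n%:R * q ^+ 2.
  move=> q0 hv; rewrite /dot.
  have -> : n%:R * q ^+ 2 = \sum_(i < n) q ^+ 2.
    by rewrite sumr_const card_ord -[RHS]mulr_natl.
  apply: ler_sum => i _; rewrite -expr2 -(real_normK (num_real _)).
  by rewrite ler_sqr ?nnegrE.
have codomE (j : 'I_p) : (j \in codom (widen_ord mp)) = (j < m)%N.
  apply/codomP/idP => [[i ->]|jm]; first exact: (ltn_ord i).
  by exists (Ordinal jm); apply/val_inj.
have yE : X *m beta_coef p k M + zv = A *m bS + r by rewrite /r [RHS]addrC subrK.
rewrite yE in est.
move=> j; rewrite -codomE.
apply: (lasso_selects_exactly (c := 1 - 2 * e) (z := e) (D2 := 6 * L)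
  (R2 := 54 * L * Q ^+ 2) _ _ _ _ Ac _ _ _ _ _ _ est) => //.
- by move=> a b /(congr1 val)/= ab; apply/val_inj.
- lra.
- by rewrite mulr_gt0// divr_gt0//; lra.
- by move=> j'; rewrite codomE -leqNgt; exact: hu.
- move=> j'; have -> : 6 * L = n%:R * s ^+ 2 by rewrite s2; field; rewrite gt_eqF.
  by apply: sumsq => // i; rewrite mxE.
- have -> : 54 * L * Q ^+ 2 = n%:R * (3 * s * Q) ^+ 2.
    by rewrite !exprMn s2; field; rewrite gt_eqF.
  by apply: sumsq => //; rewrite !mulr_ge0// ltW.
- lra.
- have -> : (e * (19 * L / e * Q)) ^+ 2 = 361 * (L ^+ 2 * Q ^+ 2).
    by field; rewrite gt_eqF.
  have -> : 6 * L * (54 * L * Q ^+ 2) = 324 * (L ^+ 2 * Q ^+ 2) by ring.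
  have : 0 < L ^+ 2 * Q ^+ 2 by rewrite mulr_gt0// exprn_gt0//; lra.
  lra.
- move=> i; rewrite mxE.
  have MQ : M * Q <= M ^+ (k - i).
    rewrite /Q -exprS; apply: ler_weXn2l; first lra.
    by move: (ltn_ord i) mk; clear; lia.
  apply: lt_le_trans MQ.
  have h1 : Num.sqrt (m%:R / (1 - 2 * e) ^+ 2) <= 8 / 7 * N.
    rewrite -(ger0_norm (_ : 0 <= 8 / 7 * N)) -?sqrtr_sqr; last lra.
    apply: ler_wsqrtr; rewrite ler_pdivrMr; last by rewrite exprn_gt0//; lra.
    have mnR : m%:R <= n%:R :> R by rewrite ler_nat.
    rewrite exprMn N2 mulrAC; apply: le_trans mnR _; rewrite ler_peMl//.
    have : (7 / 8) ^+ 2 <= (1 - 2 * e) ^+ 2 by rewrite ler_sqr ?nnegrE; lra.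
    lra.
  have h2 : Num.sqrt (54 * L * Q ^+ 2 / (1 - 2 * e)) <= 8 * (L * N) * Q.
    have q0 : 0 <= 8 * (L * N) * Q by apply: mulr_ge0; [lra|exact: ltW].
    rewrite -(ger0_norm q0) -?sqrtr_sqr.
    apply: ler_wsqrtr; rewrite ler_pdivrMr; last lra.
    have -> : (8 * (L * N) * Q) ^+ 2 * (1 - 2 * e) =
      (64 * ((L * N) ^+ 2 * (1 - 2 * e))) * Q ^+ 2 by ring.
    apply: ler_wpM2r; first exact: sqr_ge0.
    have h3 : L <= (L * N) ^+ 2.
      apply: le_trans LN1 _; rewrite expr2 ler_peMl//; lra.
    have : 0 <= (L * N) ^+ 2 * (1 - 2 * e - 7 / 8).
      by rewrite mulr_ge0 ?sqr_ge0//; lra.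
    lra.
  apply: le_lt_trans (lerD (ler_wpM2l _ h1) h2) _.
    by apply: mulr_ge0; [apply: divr_ge0; lra|exact: ltW].
  have -> : 19 * L / e * Q * (8 / 7 * N) + 8 * (L * N) * Q =
     (152 / 7 * (L * N) / e + 8 * (L * N)) * Q by ring.
  rewrite ltr_pM2r// -(ltr_pM2r e0) mulrDl divfK ?gt_eqF//.
  have : 8 * (L * N) * e <= 8 * (L * N) by rewrite ler_piMr//; lra.
  lra.
Qed.

End GoodDesign.

Section SupportRecovery.
Context {R : realType} {d : measure_display} {T : measurableType d}.
Variable (P : probability T R).

(** The five error terms are, in this order: the Frobenius norm of the selected columns,
the lattice net, the correlations of the other columns with the dual vector, the
entries of the design, and the noise. The condition on [m], namely
$m \le (1 - 8 e) n / (2 L)$, gives the correlations the exponent $- (1 + 4 e) L$,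
which beats the $p = e^L$ columns. *)
Lemma support_recovery (n p k m B : nat) (X : 'I_n * 'I_p -> {RV P >-> R})
    (z : 'I_n -> {RV P >-> R}) (sigma M L e C h : R) :
  iid_gaussian 0 (1 / n%:R) X -> iid_gaussian 0 (sigma ^+ 2) z ->
  (0 < n)%N -> (0 < m)%N -> (m <= n)%N -> (m + 4 <= k <= p)%N ->
  1 <= L -> 0 < e <= 16^-1 -> 50 * L * Num.sqrt n%:R / e <= M ->
  2 * m%:R * L <= (1 - 8 * e) * n%:R ->
  0 < C -> 0 < h -> h ^+ 2 * C <= e -> h^-1 + 1 <= B%:R ->
  exists E : set T, [/\ measurable E,
    (P E <= (8 / C + (2 ^ (m * (B + 2)))%:R * expR (- (e ^+ 2 / 1280 * n%:R))
      + p%:R * (2 * expR (- ((1 + 4 * e) * L)))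
      + (n * p)%:R * (2 * expR (- (3 * L)))
      + n%:R * (2 * expR (sigma ^+ 2 / 2 - n%:R)))%:E)%E &
    forall x, ~ E x -> forall b' : 'cV[R]_p,
      let Xx := \matrix_(i < n, j < p) X (i, j) x in
      is_lasso_estimate Xx (Xx *m beta_coef p k M + \col_i z i x)
        (19 * L / e * M ^+ (k - m)) b' ->
      forall j, (b' j 0 != 0) = (j < m)%N].
Proof.
move=> [Xind Xlaw] [_ zlaw] n0 m0 mn mkp L1 e01 hM hmL C0 h0 hC hB.
have /andP[e0 e1] := e01.
have mp : (m <= p)%N by move: mkp; clear; lia.
have nR0 : 0 < n%:R :> R by rewrite ltr0n.
have mR0 : 0 < m%:R :> R by rewrite ltr0n.
pose f := widen_ord mp.
have fI : injective f by move=> a b /(congr1 val)/= ab; apply/val_inj.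
have v0 : 0 <= 1 / n%:R :> R by rewrite divr_ge0// ltW.
have hX i : has_gaussian_mgf P (1 / n%:R) (X i) by exact: gaussian_law_mgf (Xlaw i).
have hz i : has_gaussian_mgf P (sigma ^+ 2) (z i).
  exact: gaussian_law_mgf (sqr_ge0 _) (zlaw i).
have e1' : 0 < e <= 1 by lra.
have [E1 [mE1 PE1 E1P]] := gram_lower_bound n0 m0 Xind hX fI e1' C0 h0 hC hB.
pose A x : 'M[R]_(n, m) := \matrix_(i, l) X (i, f l) x.
pose J := [set y : 'I_n * 'I_p | (y.2 < m)%N]%SET.
have mAJ i : measurable_fun setT ((fun x => gram_dual (A x) i 0) : sub_space X J -> R).
  apply: measurable_gram_dual => i' l; under eq_fun do rewrite mxE.
  by apply: measurable_sub_space; rewrite inE/= ltn_ord.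
have mAT i : measurable_fun setT (fun x => gram_dual (A x) i 0).
  apply: measurable_gram_dual => i' l; under eq_fun do rewrite mxE.
  exact: measurable_funPT.
(* For $j < m$ the column [j] is one of the columns that define the dual vector, and
nothing is required. *)
pose Q2 (j : 'I_p) : set T := if (m <= j)%N then
  [set x | (\sum_i gram_dual (A x) i 0 ^+ 2 <= m%:R / (1 - 2 * e))%R /\
    (1 - e < `|\sum_i gram_dual (A x) i 0 * X (i, j) x|)%R] else set0.
have mQ2 j : measurable (Q2 j).
  rewrite /Q2; case: ifP => // _; apply: measurableI.
    by apply: measurable_set_le => //; apply: measurable_sum => i; exact: measurable_funX.
  apply: measurable_set_lt => //; apply: measurableT_comp => //.
  by apply: measurable_sum => i; exact: measurable_funM.
have PQ2 j : (P (Q2 j) <= (2 * expR (- ((1 + 4 * e) * L)))%:E)%E.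
  rewrite /Q2; case: ifP => [mj|_]; last by rewrite measure0 lee_fin mulr_ge0// expR_ge0.
  have B0 : 0 < m%:R / (1 - 2 * e) by rewrite divr_gt0//; lra.
  have s0 : 0 <= 1 - e by lra.
  have jJ i : (i, j) \notin J by rewrite inE/= -leqNgt.
  apply: le_trans (cross_tail n0 Xind hX jJ B0 s0 mAJ) _.
  rewrite lee_fin ler_pM2l// ler_expR lerN2.
  have -> : n%:R * (1 - e) ^+ 2 / (2 * (m%:R / (1 - 2 * e))) =
      n%:R * ((1 - e) ^+ 2 * (1 - 2 * e)) / (2 * m%:R).
    by field; rewrite !gt_eqF//; lra.
  rewrite ler_pdivlMr ?mulr_gt0//.
  apply: (@le_trans _ _ ((1 + 4 * e) * ((1 - 8 * e) * n%:R))).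
    rewrite -mulrA [L * _]mulrC; apply: ler_wpM2l => //; lra.
  have e2 : 0 <= e ^+ 2 by exact: sqr_ge0.
  have -> : (1 + 4 * e) * ((1 - 8 * e) * n%:R) = n%:R * (1 - 4 * e - 32 * e ^+ 2) by ring.
  rewrite ler_pM2l//.
  have -> : (1 - e) ^+ 2 * (1 - 2 * e) = 1 - 4 * e + e ^+ 2 * (5 - 2 * e) by ring.
  have : 0 <= e ^+ 2 * (5 - 2 * e) by apply: mulr_ge0 => //; lra.
  lra.
pose E2 := [set x | exists j, Q2 j x].
pose s := Num.sqrt (6 * L / n%:R).
have s2 : s ^+ 2 = 6 * L / n%:R by rewrite sqr_sqrtr// divr_ge0//; lra.
pose E3 := [set x | exists y, (s < `|X y x|)%R].
pose E4 := [set x | exists i, (n%:R < `|z i x|)%R].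
have mE2 : measurable E2 by exact: union_bound_measurable.
have mE3 : measurable E3.
  apply: union_bound_measurable => y; apply: measurable_set_lt => //.
  exact: measurableT_comp.
have mE4 : measurable E4.
  apply: union_bound_measurable => y; apply: measurable_set_lt => //.
  exact: measurableT_comp.
exists (E1 `|` E2 `|` E3 `|` E4); split.
- by do 3! [apply: measurableU => //].
- have PE2 : (P E2 <= (p%:R * (2 * expR (- ((1 + 4 * e) * L))))%:E)%E.
    by apply: le_trans (union_bound_const mQ2 PQ2) _; rewrite card_ord.
  have PE3 : (P E3 <= ((n * p)%:R * (2 * expR (- (3 * L))))%:E)%E.
    (* The exponent $n s$ is optimal for variance $1 / n$, and gives $e^{- n s^2 / 2} = e^{- 3 L}$. *)
    have t0 : 0 <= n%:R * s by rewrite mulr_ge0// ?sqrtr_ge0// ltW.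
    apply: le_trans (max_entry_tail s hX t0) _.
    rewrite card_prod !card_ord lee_fin ler_wpM2l// ler_pM2l// ler_expR.
    have -> : (n%:R * s) ^+ 2 * (1 / n%:R) / 2 - n%:R * s * s = - (n%:R * s ^+ 2 / 2).
      by field; rewrite gt_eqF.
    rewrite s2; have -> : n%:R * (6 * L / n%:R) / 2 = 3 * L by field; rewrite gt_eqF.
    by [].
  have PE4 : (P E4 <= (n%:R * (2 * expR (sigma ^+ 2 / 2 - n%:R)))%:E)%E.
    apply: le_trans (max_entry_tail n%:R hz ler01) _.
    by rewrite card_ord expr1n !mul1r.
  rewrite !EFinD.
  apply: le_trans (measureU2 _ _ _) _; rewrite ?leeD//; first by do 2! [apply: measurableU => //].
  apply: le_trans (measureU2 _ _ _) _; rewrite ?leeD//; first by apply: measurableU.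
  by apply: le_trans (measureU2 _ _ _) _; rewrite ?leeD.
move=> x nE b' Xx est.
have XA : colsub (widen_ord mp) Xx = A x by apply/matrixP => i l; rewrite !mxE.
have Ac v : (1 - 2 * e) * dot v v <= dot (A x *m v) (A x *m v).
  have := E1P x _ (fun j => v j 0).
  have -> : dot v v = \sum_j v j 0 ^+ 2 by apply: eq_bigr => j _; rewrite expr2.
  have -> : dot (A x *m v) (A x *m v) = \sum_i (\sum_j v j 0 * X (i, f j) x) ^+ 2.
    apply: eq_bigr => i _; rewrite mxE -expr2; congr (_ ^+ 2).
    by apply: eq_bigr => j _; rewrite mxE mulrC.
  by apply => Ex; apply: nE; left; left; left.
apply: (recovery_of_good_design (mp := mp) n0 mn mkp L1 e01 hM _ _ _ _ est).
- by move=> v; rewrite XA; exact: Ac.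
- move=> j mj; rewrite XA leNgt; apply/negP => Hj; apply: nE; left; left; right.
  exists j; rewrite /Q2 mj; split.
    have := gram_dual_norm (_ : 0 < 1 - 2 * e) Ac.
    by move=> /(_ _)/le_trans; under eq_bigr do rewrite expr2; apply => //; lra.
  by move: Hj; rewrite /dot; under eq_bigr do rewrite [X in _ * X]mxE [X in _ * X]mxE.
- move=> i j; rewrite mxE leNgt; apply/negP => Hj; apply: nE; left; right.
  by exists (i, j).
- move=> i; rewrite mxE leNgt; apply/negP => Hj; apply: nE; right; by exists i.
Qed.

End SupportRecovery.

(** * Selection counts *)

Section SelectionCounts.
Context {R : realType} {d : measure_display} {T : measurableType d}.

Lemma measurable_selection_count p (g : 'I_p -> T -> R) (S : pred 'I_p) :
  (forall j, measurable_fun setT (g j)) ->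
  measurable_fun setT (fun w => #|[pred j | (g j w != 0) && S j]|%:R : R).
Proof.
move=> mg.
have -> : (fun w => #|[pred j | (g j w != 0) && S j]|%:R : R) =
    fun w => \sum_j (\1_[set w | g j w != 0 /\ S j] w : R).
  apply/funext => w; rewrite -sum1_card natr_sum big_mkcond/=.
  apply: eq_bigr => j _; rewrite -[j \in _]/((g j w != 0) && S j) indicE.
  case: ifP => gS; first by rewrite mem_set; last exact/andP.
  by rewrite memNset// => /andP; rewrite gS.
apply: measurable_sum => j; apply: measurable_indic.
have [Sj|nSj] := boolP (S j); last first.
  rewrite [X in measurable X](_ : _ = set0)//.
  by apply/seteqP; split=> // w [].
rewrite [X in measurable X](_ : _ = ~` (g j @^-1` [set 0])).
  by apply: measurableC; rewrite -[X in measurable X]setTI; exact: mg.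
by apply/seteqP; split=> w /=; [case=> /eqP|move=> /eqP].
Qed.

Lemma measurable_true_selections p (beta : 'cV[R]_p) (g : 'I_p -> T -> R) :
  (forall j, measurable_fun setT (g j)) ->
  measurable_fun setT (fun w => (true_selections beta (\col_j g j w))%:R : R).
Proof.
move=> mg; rewrite /true_selections.
have := measurable_selection_count (fun j => beta j 0 != 0) mg.
congr (measurable_fun _ _); apply/funext => w; congr (_%:R).
by apply: eq_card => j; rewrite !inE mxE.
Qed.

Lemma measurable_false_selections p (beta : 'cV[R]_p) (g : 'I_p -> T -> R) :
  (forall j, measurable_fun setT (g j)) ->
  measurable_fun setT (fun w => (false_selections beta (\col_j g j w))%:R : R).
Proof.
move=> mg; rewrite /false_selections.
have := measurable_selection_count (fun j => beta j 0 == 0) mg.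
congr (measurable_fun _ _); apply/funext => w; congr (_%:R).
by apply: eq_card => j; rewrite !inE mxE.
Qed.

Lemma beta_coef_neq0 p k (M : R) (j : 'I_p) : M != 0 -> (j < k)%N ->
  @beta_coef R p k M j 0 != 0.
Proof. by move=> M0 jk; rewrite mxE jk expf_neq0. Qed.

Lemma selections_of_support p k m (M : R) (b : 'cV[R]_p) :
  M != 0 -> (m <= k)%N -> (m <= p)%N -> (forall j, (b j 0 != 0) = (j < m)%N) ->
  true_selections (beta_coef p k M) b = m /\ false_selections (beta_coef p k M) b = 0%N.
Proof.
move=> M0 mk mp hb; split; last first.
  apply: eq_card0 => j; rewrite !inE hb.
  by have [jm|//] := ltnP j m; rewrite (negbTE (beta_coef_neq0 M0 (leq_trans jm mk))).
rewrite /true_selections -sum1_card.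
rewrite (eq_bigl (fun j : 'I_p => (j < m)%N)).
  by rewrite (big_ord_narrow mp) big_const_ord iter_addn_0 mul1n.
move=> j; rewrite !inE hb.
by have [jm|//] := ltnP j m; rewrite (beta_coef_neq0 M0 (leq_trans jm mk)).
Qed.

End SelectionCounts.


(** * The asymptotic regime *)

Section Diagonal.
Context {R : realType}.

(** At index [l], use the largest level $N \le l$ that can be reached. *)
Lemma diagonal_parameter (Q : nat -> nat -> R -> Prop) :
  (forall N, \forall l \near \oo, exists2 lam, 0 < lam & Q N l lam) ->
  exists lam : nat -> R, (forall l, 0 < lam l) /\
    forall N, \forall l \near \oo, exists2 N', (N <= N')%N & Q N' l (lam l).
Proof.
move=> H.
pose S l N := (N <= l)%N && `[< exists2 lam, 0 < lam & Q N l lam >].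
have step l : exists lam : R, 0 < lam /\
    forall N, S l N -> exists2 N', (N <= N')%N & Q N' l lam.
  have [exS|nS] := pselect (exists N, S l N); last first.
    by exists 1; split=> // N SN; exfalso; apply: nS; exists N.
  have bS N : S l N -> (N <= l)%N by case/andP.
  case: (ex_maxnP exS bS) => N0 /andP[_ /asboolP[lam lam0 QN0]] maxN0.
  by exists lam; split=> // N SN; exists N0 => //; exact: maxN0.
have [lam hlam] := choice step.
exists lam; split=> [l|N]; first by have [] := hlam l.
near=> l; have [_] := hlam l; apply; apply/andP; split.
  by near: l; exact: nbhs_infty_ge.
by apply/asboolP; near: l; exact: H.
Unshelve. all: end_near.
Qed.

Lemma ereal_cvg0 (u : nat -> \bar R) :
  (forall l, (0 <= u l)%E) ->
  (forall e : R, 0 < e -> \forall l \near \oo, (u l <= e%:E)%E) ->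
  u @ \oo --> 0%E.
Proof.
move=> u0 ue; apply/fine_cvgP; split.
  near=> l; rewrite ge0_fin_numE//.
  by apply: (@le_lt_trans _ _ 1%:E); [near: l; exact: ue|rewrite ltry].
apply/cvgr0Pnorm_le => e e0; near=> l.
have ul : (u l <= e%:E)%E by near: l; exact: ue.
rewrite /= ger0_norm; last exact: fine_ge0.
have ufin : u l \is a fin_num by rewrite ge0_fin_numE//; apply: le_lt_trans ul (ltry _).
by rewrite -lee_fin fineK.
Unshelve. all: end_near.
Qed.

End Diagonal.


Section Growth.
Context {R : realType}.

Lemma ln_le_powR (x c : R) : 0 < x -> 0 < c -> ln x <= x `^ c / c.
Proof.
move=> x0 c0; rewrite ler_pdivlMr// mulrC -ln_powR.
have y0 : 0 < x `^ c by exact: powR_gt0.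
have := @le_ln1Dx R (x `^ c - 1); rewrite [1 + _]addrC subrK => h.
by apply: le_trans (h _) _; lra.
Qed.

Variables (n p : nat -> nat) (delta : R).
Hypotheses (hdelta : 0 < delta) (hn : n @ \oo --> \oo) (hp : p @ \oo --> \oo)
  (hnp : (fun l => (n l)%:R / (p l)%:R : R) @ \oo --> delta).

Lemma near_natr_ge (q : nat -> nat) (K : R) : q @ \oo --> \oo ->
  \forall l \near \oo, K <= (q l)%:R.
Proof.
move=> /cvgnyPge hq; have := hq (Num.bound K); apply: filterS => l h.
have [K0|K0] := leP K 0; first exact: le_trans K0 _.
by apply: le_trans (ltW (archi_boundP (ltW K0))) _; rewrite ler_nat.
Qed.

Lemma near_ln_ge (K : R) : \forall l \near \oo, K <= ln (p l)%:R.
Proof.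
near=> l.
have h : expR K <= (p l)%:R by near: l; exact: near_natr_ge.
rewrite -(expRK K) ler_ln ?posrE ?expR_gt0//.
exact: lt_le_trans (expR_gt0 _) h.
Unshelve. all: end_near.
Qed.

Lemma near_ratio_bounds : \forall l \near \oo,
  [/\ 0 < (p l)%:R :> R, (n l)%:R <= (delta + 1) * (p l)%:R &
      (p l)%:R <= 2 / delta * (n l)%:R].
Proof.
have d2 : delta / 2 < delta by move: hdelta => ?; lra.
near=> l.
have p1 : 1 <= (p l)%:R :> R by near: l; exact: near_natr_ge.
have p0 : 0 < (p l)%:R :> R by lra.
split=> //.
  rewrite -ler_pdivrMr//; apply: ltW; near: l.
  by apply: (cvgr_lt delta hnp); lra.
have : delta / 2 < (n l)%:R / (p l)%:R.
  by near: l; exact: (cvgr_gt delta hnp).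
rewrite ltr_pdivlMr// => h.
rewrite mulrAC ler_pdivlMr//; lra.
Unshelve. all: end_near.
Qed.

(** This is where $a > 1/2$ enters: $\ln p = O(p^c) = O(n^c)$ with
$c = (a - 1/2) / 2$, and $n^{1/2 + c} = n^{a - c}$. *)
Lemma near_ln_sqrt_le (a K : R) : 2^-1 < a -> 0 < K ->
  \forall l \near \oo, K * ln (p l)%:R * Num.sqrt (n l)%:R <= (n l)%:R `^ a.
Proof.
move=> ha K0; pose c := (a - 2^-1) / 2.
have c0 : 0 < c by rewrite /c; lra.
pose G := K * ((2 / delta) `^ c / c).
have G0 : 0 <= G by rewrite /G mulr_ge0 ?(ltW K0)// divr_ge0 ?powR_ge0// ltW.
near=> l.
have [p0 _ pn] : [/\ 0 < (p l)%:R :> R, (n l)%:R <= (delta + 1) * (p l)%:R &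
    (p l)%:R <= 2 / delta * (n l)%:R] by near: l; exact: near_ratio_bounds.
have n1 : 1 <= (n l)%:R :> R by near: l; exact: near_natr_ge.
have nG : G `^ c^-1 <= (n l)%:R by near: l; exact: near_natr_ge.
have n0 : 0 < (n l)%:R :> R by lra.
have d0 : 0 <= 2 / delta by rewrite divr_ge0// ltW.
have h1 : ln (p l)%:R <= (2 / delta) `^ c / c * (n l)%:R `^ c.
  apply: le_trans (ln_le_powR p0 c0) _; rewrite mulrAC ler_pM2r ?invr_gt0//.
  rewrite -powRM ?(ltW n0)//; apply: ge0_ler_powR; rewrite ?nnegrE ?(ltW c0)//.
  by rewrite mulr_ge0// ltW.
have h2 : G <= (n l)%:R `^ c.
  have -> : G = (G `^ c^-1) `^ c by rewrite -powRrM mulVf ?powRr1// gt_eqF.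
  by apply: ge0_ler_powR; rewrite ?nnegrE ?powR_ge0 ?(ltW c0) ?(ltW n0).
have -> : (n l)%:R `^ a = (n l)%:R `^ c * (n l)%:R `^ c * (n l)%:R `^ 2^-1 :> R.
  rewrite -!powRD; last 2 first.
  - by apply/implyP => _; rewrite gt_eqF.
  - by apply/implyP => _; rewrite gt_eqF.
  by congr powR; rewrite /c; field.
rewrite powR12_sqrt ?(ltW n0)//; apply: ler_wpM2r; first exact: sqrtr_ge0.
apply: le_trans (ler_wpM2l (ltW K0) h1) _; rewrite mulrA.
by apply: ler_wpM2r => //; exact: powR_ge0.
Unshelve. all: end_near.
Qed.

Lemma near_ln_le (K : R) : 0 < K ->
  \forall l \near \oo, K * ln (p l)%:R <= (n l)%:R.
Proof.
move=> K0; near=> l.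
have n1 : 1 <= (n l)%:R :> R by near: l; exact: near_natr_ge.
have h : K * ln (p l)%:R * Num.sqrt (n l)%:R <= (n l)%:R `^ 1.
  by near: l; apply: near_ln_sqrt_le => //; lra.
have L0 : 0 <= ln (p l)%:R :> R by near: l; exact: near_ln_ge.
rewrite powRr1 in h; last lra.
have s1 : 1 <= Num.sqrt (n l)%:R :> R by rewrite -[leLHS]sqrtr1 ler_wsqrtr.
have KL0 : 0 <= K * ln (p l)%:R by apply: mulr_ge0 => //; exact: ltW.
by apply: le_trans h; rewrite ler_peMr.
Unshelve. all: end_near.
Qed.

End Growth.

Section ErrorTerms.
Context {R : realType}.

Lemma expRN_le_inv (x : R) : 0 < x -> expR (- x) <= x^-1.
Proof.
move=> x0; rewrite expRN lef_pV2 ?posrE ?expR_gt0//.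
have := expR_ge1Dx x; lra.
Qed.

(** The number of lattice points is at most $e^{m (B + 2)}$ with $m \le n / (2 L)$, which
uses up at most half of the exponent of the chi-square tail once [L] is large. *)
Lemma net_error_le (n m B : nat) (L e eta : R) : 0 < e -> 0 < eta -> 0 < L ->
  2 * m%:R * L <= n%:R -> 1280 * (B + 2)%:R / e ^+ 2 <= L ->
  2560 * 8 / (e ^+ 2 * eta) <= n%:R ->
  (2 ^ (m * (B + 2)))%:R * expR (- (e ^+ 2 / 1280 * n%:R)) <= eta / 8.
Proof.
move=> e0 eta0 L0 hm hL hn.
have e2 : 0 < e ^+ 2 by exact: exprn_gt0.
have h2 : (2 ^ (m * (B + 2)))%:R <= expR (m%:R * (B + 2)%:R) :> R.
  rewrite natrX -natrM -[X in expR X]mulr1 expRM_natl.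
  by rewrite lerXn2r ?nnegrE ?expR_ge0//; have := @expR_ge1Dx R 1; lra.
have h3 : m%:R * (B + 2)%:R <= e ^+ 2 / 2560 * n%:R.
  rewrite -(ler_pM2l (_ : 0 < 2 * L)); last lra.
  apply: (@le_trans _ _ (n%:R * (B + 2)%:R)).
    have -> : 2 * L * (m%:R * (B + 2)%:R) = 2 * m%:R * L * (B + 2)%:R by ring.
    exact: ler_wpM2r.
  move: hL; rewrite ler_pdivrMr// => hL.
  have := ler_wpM2r (ler0n R n) hL; lra.
apply: le_trans (ler_wpM2r (expR_ge0 _) h2) _; rewrite -expRD.
have x0 : 0 < e ^+ 2 / 2560 * n%:R.
  have h : 0 < 2560 * 8 / (e ^+ 2 * eta).
    by apply: divr_gt0; [lra|exact: mulr_gt0].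
  by apply: mulr_gt0; [lra|exact: lt_le_trans h hn].
apply: (@le_trans _ _ (expR (- (e ^+ 2 / 2560 * n%:R)))).
  by rewrite ler_expR; lra.
apply: le_trans (expRN_le_inv x0) _.
have eta8 : 0 < eta / 8 by lra.
rewrite -(invrK (eta / 8)) lef_pV2 ?posrE ?invr_gt0//.
have ee0 : 0 < e ^+ 2 * eta by exact: mulr_gt0.
move: hn; rewrite (ler_pdivrMr _ _ ee0) => hn.
rewrite invf_div (ler_pdivrMr _ _ eta0); lra.
Qed.

Lemma cross_error_le (p e eta L : R) : 0 < e -> 0 < eta -> p = expR L ->
  4 / (e * eta) <= L -> p * (2 * expR (- ((1 + 4 * e) * L))) <= eta / 8.
Proof.
move=> e0 eta0 -> hL.
have L0 : 0 < L by apply: lt_le_trans hL; rewrite divr_gt0// mulr_gt0.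
have x0 : 0 < 4 * e * L by rewrite !mulr_gt0.
have -> : expR L * (2 * expR (- ((1 + 4 * e) * L))) = 2 * expR (- (4 * e * L)).
  rewrite mulrCA -expRD; congr (_ * expR _); ring.
have h := expRN_le_inv x0.
have h2 : (4 * e * L)^-1 <= eta / 16.
  rewrite -(invrK (eta / 16)) lef_pV2 ?posrE// ?invr_gt0 ?divr_gt0//.
  move: hL; rewrite ler_pdivrMr ?mulr_gt0// => hL.
  rewrite invf_div ler_pdivrMr//; lra.
lra.
Qed.

Lemma entry_error_le (n p K eta L : R) : 0 < eta -> 0 < K -> p = expR L ->
  n <= K * p -> 16 * K / eta <= L -> n * p * (2 * expR (- (3 * L))) <= eta / 8.
Proof.
move=> eta0 K0 pL np hL.
have L0 : 0 < L by apply: lt_le_trans hL; rewrite divr_gt0// mulr_gt0.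
have p0 : 0 <= p by rewrite pL expR_ge0.
have h1 : n * p * (2 * expR (- (3 * L))) <= K * p * p * (2 * expR (- (3 * L))).
  by apply: ler_wpM2r; [rewrite mulr_ge0// expR_ge0|exact: ler_wpM2r].
apply: le_trans h1 _.
have -> : K * p * p * (2 * expR (- (3 * L))) = 2 * K * expR (- L).
  have -> : - L = L + L + - (3 * L) by ring.
  by rewrite !expRD pL; ring.
have h := ler_wpM2l (ltW K0) (expRN_le_inv L0).
have h2 : K * L^-1 <= eta / 16.
  rewrite ler_pdivrMr//; move: hL; rewrite ler_pdivrMr//; lra.
lra.
Qed.

Lemma noise_error_le (n v eta : R) : 0 < eta -> 32 * expR v / eta <= n ->
  n * (2 * expR (v - n)) <= eta / 8.
Proof.
move=> eta0 hn.
have n0 : 0 < n by apply: lt_le_trans hn; rewrite divr_gt0// mulr_gt0// expR_gt0.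
have h : 1 + n ^+ 2 / 2 <= expR n := expR_ge1Dxn 1 (ltW n0).
have v0 : 0 < expR v := expR_gt0 v.
have h1 : n * expR (- n) <= 2 / n.
  rewrite expRN ler_pdivrMr ?expR_gt0//.
  have : 0 <= 2 / n by rewrite divr_ge0// ltW.
  move=> h2; apply: le_trans (ler_wpM2l h2 h).
  have -> : 2 / n * (1 + n ^+ 2 / 2) = 2 / n + n by field; rewrite gt_eqF.
  lra.
have -> : n * (2 * expR (v - n)) = 2 * expR v * (n * expR (- n)).
  by rewrite expRD; ring.
have v2 : 0 <= 2 * expR v by lra.
apply: le_trans (ler_wpM2l v2 h1) _.
rewrite mulrA ler_pdivrMr//; move: hn; rewrite ler_pdivrMr//; lra.
Qed.

End ErrorTerms.

Section Regime.
Context {R : realType}.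

Lemma selection_size_exists (n : nat) (L eta : R) : 0 < eta <= 1 -> 1 <= L ->
  4 * L <= n%:R -> 4 / eta * L <= n%:R ->
  exists m : nat, [/\ (0 < m)%N, (m <= n)%N, 2 * m%:R * L <= (1 - eta / 4) * n%:R &
    `|m%:R / (n%:R / (2 * L)) - 1| < eta].
Proof.
move=> /andP[eta0 eta1] L1 L4 Leta.
have n0 : 0 < n%:R :> R by lra.
have L20 : 0 < 2 * L by lra.
pose x := (1 - eta / 4) * n%:R / (2 * L).
have n34 : 3 / 4 * n%:R <= (1 - eta / 4) * n%:R by apply: ler_wpM2r; lra.
have n44 : (1 - eta / 4) * n%:R <= n%:R by rewrite ler_piMl//; lra.
have x1 : 1 <= x by rewrite /x ler_pdivlMr//; lra.
have x0 : 0 <= x by lra.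
have /andP[mx xm] := truncn_itv x0; set m := Num.truncn x in mx xm.
have mL : 2 * m%:R * L <= (1 - eta / 4) * n%:R.
  by move: mx; rewrite /x ler_pdivlMr//; lra.
have etan : 0 < eta * n%:R by exact: mulr_gt0.
exists m; split=> //.
- by rewrite /m truncn_gt0.
- rewrite -(ler_nat R); have : m%:R <= m%:R * L by rewrite ler_peMr.
  lra.
have -> : m%:R / (n%:R / (2 * L)) = 2 * m%:R * L / n%:R.
  by field; rewrite !gt_eqF//; lra.
rewrite ltr_norml; apply/andP; split; last by rewrite ltrBlDr ltr_pdivrMr//; lra.
rewrite ltrBrDr ltr_pdivlMr//.
move: xm; rewrite /x -[m.+1%:R]natr1 ltr_pdivrMr// => xm.
have Leta2 : 2 * L <= eta / 2 * n%:R.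
  by move: Leta; rewrite mulrAC ler_pdivrMr//; lra.
lra.
Qed.

Lemma selection_size_below (n p k m : nat) (L K eps : R) : 0 < eps -> 0 < L -> 0 < p%:R :> R ->
  m%:R * L <= n%:R / 2 -> n%:R <= K * p%:R -> 2 * K / eps <= L ->
  16 / eps <= p%:R -> eps / 2 < k%:R / p%:R -> (m + 4 <= k)%N.
Proof.
move=> eps0 L0 p0 mLn np Leps peps kp; rewrite -(ler_nat R) natrD.
move: kp; rewrite ltr_pdivlMr// => kp.
move: peps; rewrite ler_pdivrMr// => peps.
have : m%:R <= eps / 4 * p%:R.
  rewrite -(ler_pM2r L0); apply: le_trans mLn _.
  move: Leps; rewrite ler_pdivrMr// => Leps.
  have := ler_wpM2r (ltW p0) Leps; lra.
lra.
Qed.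

(** For an accuracy [eta], the margin is $e = eta / 32$, so that $m$ is close to
$(1 - eta / 4) n / (2 L)$, and $C = 32 / eta$ makes the first error term equal to
$eta / 4$; the four others are eventually at most $eta / 8$. *)
Lemma near_parameters (delta eps sigma a eta : R) (n p k : nat -> nat) (M : nat -> R) :
  0 < delta -> 0 < eps < 1 -> 2^-1 < a -> 0 < eta <= 1 ->
  n @ \oo --> \oo -> p @ \oo --> \oo ->
  (fun l => (n l)%:R / (p l)%:R : R) @ \oo --> delta ->
  (fun l => (k l)%:R / (p l)%:R : R) @ \oo --> eps ->
  (\forall l \near \oo, (n l)%:R `^ a <= M l) ->
  let e := eta / 32 in let C := 32 / eta in
  exists h B, [/\ 0 < h, h ^+ 2 * C <= e, h^-1 + 1 <= B%:R &
    \forall l \near \oo, let L := ln (p l)%:R in exists m : nat,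
     [/\ [/\ (0 < n l)%N, (0 < m)%N, (m <= n l)%N & (m + 4 <= k l <= p l)%N],
         [/\ 1 <= L, 50 * L * Num.sqrt (n l)%:R / e <= M l &
             2 * m%:R * L <= (1 - 8 * e) * (n l)%:R],
         8 / C + (2 ^ (m * (B + 2)))%:R * expR (- (e ^+ 2 / 1280 * (n l)%:R))
           + (p l)%:R * (2 * expR (- ((1 + 4 * e) * L)))
           + (n l * p l)%:R * (2 * expR (- (3 * L)))
           + (n l)%:R * (2 * expR (sigma ^+ 2 / 2 - (n l)%:R)) <= eta &
         `|m%:R / ((n l)%:R / (2 * L)) - 1| < eta]].
Proof.
move=> delta0 /andP[eps0 eps1] ha /andP[eta0 eta1] hn hp hnp hkp hM e C.
have e0 : 0 < e by rewrite /e; lra.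
have C0 : 0 < C by apply: divr_gt0.
exists (Num.sqrt (e / C)).
have h0 : 0 < Num.sqrt (e / C) by rewrite sqrtr_gt0 divr_gt0.
exists (Num.bound ((Num.sqrt (e / C))^-1 + 1)).
set B := Num.bound _.
split => //.
- have eC0 : 0 <= e / C by rewrite divr_ge0// ltW.
  by rewrite (sqr_sqrtr eC0) divfK// gt_eqF.
- by apply/ltW/archi_boundP; rewrite addr_ge0// invr_ge0 ltW.
have K0 : 0 < delta + 1 by lra.
have d50 : 0 < 50 / e by apply: divr_gt0.
have eta4 : 0 < 4 / eta by apply: divr_gt0.
have half_lt : eps / 2 < eps by lra.
have sum5 x1 x2 x3 x4 x5 : x1 = eta / 4 -> x2 <= eta / 8 -> x3 <= eta / 8 ->
    x4 <= eta / 8 -> x5 <= eta / 8 -> x1 + x2 + x3 + x4 + x5 <= eta.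
  by move=> *; lra.
have e8 : 1 - eta / 4 = 1 - 8 * e by rewrite /e; lra.
have e8le (y : R) : 0 <= y -> (1 - eta / 4) * y <= y by move=> y0; rewrite ler_piMl//; lra.
have t1 : 8 / C = eta / 4 by rewrite /C invf_div; lra.
have two_half (y w : R) : 2 * y <= w -> y <= w / 2 by move=> ?; lra.
near=> l.
have p1 : 1 <= (p l)%:R :> R by near: l; exact: near_natr_ge.
have p0 := lt_le_trans ltr01 p1.
have [_ np _] : [/\ 0 < (p l)%:R :> R, (n l)%:R <= (delta + 1) * (p l)%:R &
    (p l)%:R <= 2 / delta * (n l)%:R] by near: l; exact: near_ratio_bounds.
have n1 : 1 <= (n l)%:R :> R by near: l; exact: near_natr_ge.
have n0 := lt_le_trans ltr01 n1.
have L1 : 1 <= ln (p l)%:R :> R by near: l; exact: near_ln_ge.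
have L4 : 4 * ln (p l)%:R <= (n l)%:R :> R.
  by near: l; apply: (near_ln_le delta0 hn hp hnp).
have Leta : 4 / eta * ln (p l)%:R <= (n l)%:R.
  by near: l; apply: (near_ln_le delta0 hn hp hnp).
have Leps : 2 * (delta + 1) / eps <= ln (p l)%:R by near: l; exact: near_ln_ge.
have peps : 16 / eps <= (p l)%:R by near: l; exact: near_natr_ge.
have kp1 : (k l)%:R / (p l)%:R < 1 :> R by near: l; exact: (cvgr_lt eps hkp).
have epsh : eps / 2 < (k l)%:R / (p l)%:R by near: l; exact: (cvgr_gt eps hkp).
have Lnet : 1280 * (B + 2)%:R / e ^+ 2 <= ln (p l)%:R by near: l; exact: near_ln_ge.
have nnet : 2560 * 8 / (e ^+ 2 * eta) <= (n l)%:R by near: l; exact: near_natr_ge.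
have Lcross : 4 / (e * eta) <= ln (p l)%:R by near: l; exact: near_ln_ge.
have Lentry : 16 * (delta + 1) / eta <= ln (p l)%:R by near: l; exact: near_ln_ge.
have nnoise : 32 * expR (sigma ^+ 2 / 2) / eta <= (n l)%:R.
  by near: l; exact: near_natr_ge.
have nM : (n l)%:R `^ a <= M l by near: l.
have Lsqrt : 50 / e * ln (p l)%:R * Num.sqrt (n l)%:R <= (n l)%:R `^ a.
  by near: l; apply: (near_ln_sqrt_le delta0 hn hp hnp).
have pE : (p l)%:R = expR (ln (p l)%:R) :> R by rewrite lnK.
set L := ln (p l)%:R in L1 L4 Leta Leps Lnet Lcross Lentry Lsqrt pE *.
have L0 := lt_le_trans ltr01 L1.
have eta01 : 0 < eta <= 1 by apply/andP.
have [m [m0 mn mL msize]] := selection_size_exists eta01 L1 L4 Leta.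
have mLn : 2 * m%:R * L <= (n l)%:R by exact: le_trans mL (e8le _ (ltW n0)).
have mLn2 : m%:R * L <= (n l)%:R / 2 by apply: two_half; rewrite mulrA.
exists m; split=> //.
- split=> //; first by rewrite -(ltr0n R).
  rewrite (selection_size_below eps0 L0 p0 mLn2 np Leps peps epsh)/=.
  by move: kp1; rewrite ltr_pdivrMr// mul1r ltr_nat => /ltnW.
- split=> //; last by rewrite -e8.
  apply: le_trans nM; apply: le_trans Lsqrt; rewrite le_eqVlt; apply/orP; left.
  by apply/eqP; clear; ring.
apply: sum5 => //.
- exact: (net_error_le (L := L)).
- exact: cross_error_le.
- by rewrite natrM; exact: (entry_error_le (K := delta + 1)).
- exact: noise_error_le.
Unshelve. all: end_near.
Qed.

End Regime.

(** * The theorem *)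

Theorem proposition3p2 (R : realType) (delta eps sigma a : R)
  (hdelta : 0 < delta) (heps : 0 < eps < 1) (hsigma : 0 <= sigma)
  (ha : 2^-1 < a)
  (* the sequence of problems, indexed by l *)
  (n p k : nat -> nat) (M : nat -> R)
  (hn : n @ \oo --> \oo) (hp : p @ \oo --> \oo)
  (hnp : (fun l => (n l)%:R / (p l)%:R : R) @ \oo --> delta)
  (hkp : (fun l => (k l)%:R / (p l)%:R : R) @ \oo --> eps)
  (hM : \forall l \near \oo, (n l)%:R `^ a <= M l)
  (d : nat -> measure_display) (T : forall l, measurableType (d l))
  (P : forall l, probability (T l) R)
  (X : forall l, 'I_(n l) * 'I_(p l) -> {RV (P l) >-> R})
  (z : forall l, 'I_(n l) -> {RV (P l) >-> R})
  (hX : forall l, iid_gaussian 0 (1 / (n l)%:R) (X l))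
  (hz : forall l, iid_gaussian 0 (sigma ^+ 2) (z l))
  (hXz : forall l, independent_families (X l) (z l))
  (* betahat l lambda is the Lasso estimate, as a random vector *)
  (betahat : forall l, R -> 'I_(p l) -> {RV (P l) >-> R})
  (hbetahat : forall l (lambda : R), 0 < lambda -> forall w : T l,
     let Xw := \matrix_(i < n l, j < p l) X l (i, j) w in
     let yw := Xw *m beta_coef (p l) (k l) (M l) + \col_i z l i w in
     is_lasso_estimate Xw yw lambda (\col_j betahat l lambda j w)) :
  exists lambda : nat -> R, [/\ (forall l, 0 < lambda l),
    is_oP1 P (fun l w =>
      (true_selections (beta_coef (p l) (k l) (M l))
         (\col_j betahat l (lambda l) j w))%:R
      / ((n l)%:R / (2 * ln (p l)%:R)) - 1)
    & (fun l => P l [set w |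
         false_selections (beta_coef (p l) (k l) (M l))
           (\col_j betahat l (lambda l) j w) = 0%N]) @ \oo --> 1%E].
Proof.
have e0 (N : nat) : 0 < N.+1%:R^-1 :> R by rewrite invr_gt0 ltr0n.
have e1 (N : nat) : N.+1%:R^-1 <= 1 :> R by rewrite invf_le1 ?ltr0n// ler1n.
pose ratio l (lam : R) w := (true_selections (beta_coef (p l) (k l) (M l))
    (\col_j betahat l lam j w))%:R / ((n l)%:R / (2 * ln (p l)%:R)) - 1 : R.
pose bad1 (e : R) l (lam : R) := [set w | e <= `|ratio l lam w|].
pose bad2 l (lam : R) := [set w | false_selections (beta_coef (p l) (k l) (M l))
    (\col_j betahat l lam j w) <> 0%N].
have mratio l lam : measurable_fun setT (ratio l lam).
  apply: measurable_funB => //; apply: measurable_funM => //.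
  by apply: measurable_true_selections => j; exact: measurable_funPT.
have mbad1 e l lam : measurable (bad1 e l lam).
  by apply: measurable_set_le => //; exact: measurableT_comp.
have mbad2 l lam : measurable (bad2 l lam).
  have mf := measurable_false_selections (beta_coef (p l) (k l) (M l))
    (fun j => measurable_funPT (betahat l lam j)).
  have := measurable_set_lt (measurable_cst (0 : R)) mf.
  congr measurable; apply/seteqP; split=> w /=; rewrite ltr0n lt0n;
    by move/eqP.
pose Q (N l : nat) (lam : R) := (P l (bad1 (N.+1%:R^-1)%R l lam) <= (N.+1%:R^-1)%:E)%E /\
  (P l (bad2 l lam) <= (N.+1%:R^-1)%:E)%E.
have good N : \forall l \near \oo, exists2 lam, 0 < lam & Q N l lam.
  have eta01 : 0 < (N.+1%:R^-1 : R) <= 1 by rewrite e0 e1.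
  have eta32 : 0 < (N.+1%:R^-1 : R) / 32 <= 16^-1.
    by have := e0 N; have := e1 N; move: (N.+1%:R^-1 : R) => x ? ?; lra.
  have C0 : 0 < 32 / (N.+1%:R^-1 : R) by rewrite divr_gt0.
  have [h [B [h0 hC hB par]]] := near_parameters sigma hdelta heps ha eta01 hn hp hnp hkp hM.
  apply: filterS par => l [m [[n0 m0 mn mkp] [L1 hMl mL] err size]].
  (* Off the event [E] the selected set is exactly the set of the first [m] indices, so
both counts are known. *)
  have [E [mE PE EP]] := support_recovery (hX l) (hz l) n0 m0 mn mkp L1 eta32 hMl mL
    C0 h0 hC hB.
  have /andP[eta0 _] := eta32.
  have M0 : 0 < M l.
    apply: lt_le_trans hMl; rewrite divr_gt0// mulr_gt0 ?sqrtr_gt0 ?ltr0n//.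
    by rewrite mulr_gt0//; lra.
  pose lam := 19 * ln (p l)%:R / (N.+1%:R^-1 / 32) * M l ^+ (k l - m).
  have lam0 : 0 < lam.
    by rewrite mulr_gt0 ?exprn_gt0// divr_gt0// mulr_gt0//; lra.
  have PEeta : (P l E <= (N.+1%:R^-1)%:E)%E by apply: le_trans PE _; rewrite lee_fin.
  have sel w : ~ E w -> true_selections (beta_coef (p l) (k l) (M l))
        (\col_j betahat l lam j w) = m /\
      false_selections (beta_coef (p l) (k l) (M l)) (\col_j betahat l lam j w) = 0%N.
    move=> nE; apply: selections_of_support.
    - by rewrite gt_eqF.
    - by move: mkp; clear; lia.
    - by move: mkp; clear; lia.
    - exact: (EP w nE _ (hbetahat l lam lam0 w)).
  exists lam => //; split; apply: le_trans PEeta.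
    apply: le_measure; rewrite ?inE// => w /= bw; apply: contrapT => nE.
    have [tE _] := sel w nE.
    by move: bw; rewrite /bad1/= /ratio tE leNgt size.
  apply: le_measure; rewrite ?inE// => w /= bw; apply: contrapT => nE.
  by have [_ fE] := sel w nE.
have [lam [lam0 lamQ]] := diagonal_parameter good.
exists lam; split=> // [e epos|].
  apply: ereal_cvg0 => [l|e' e'0]; first exact: measure_ge0.
  have m0 : 0 < Num.min e e' by rewrite lt_min epos e'0.
  have [N Nle] : exists N : nat, N.+1%:R^-1 <= Num.min e e'.
    exists (Num.bound (Num.min e e')^-1).
    rewrite -[leRHS]invrK lef_pV2 ?posrE ?invr_gt0//.
    by apply/ltW/(lt_trans (archi_boundP _)); rewrite ?invr_ge0 ?ltW// ltr_nat.
  apply: filterS (lamQ N) => l [N' NN' [Q1 _]].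
  have N'le : N'.+1%:R^-1 <= Num.min e e'.
    by apply: le_trans Nle; rewrite lef_pV2 ?posrE// ler_nat ltnS.
  move: N'le; rewrite le_min => /andP[N'e N'e'].
  apply: (@le_trans _ _ (P l (bad1 (N'.+1%:R^-1)%R l (lam l)))); last first.
    by apply: le_trans Q1 _; rewrite lee_fin.
  by apply: le_measure; rewrite ?inE//; [exact: mbad1|move=> w; exact: le_trans].
have cvg2 : (fun l => P l (bad2 l (lam l))) @ \oo --> 0%E.
  apply: ereal_cvg0 => [l|e' e'0]; first exact: measure_ge0.
  have [N Nle] : exists N : nat, N.+1%:R^-1 <= e'.
    exists (Num.bound e'^-1).
    rewrite -[leRHS]invrK lef_pV2 ?posrE ?invr_gt0//.
    by apply/ltW/(lt_trans (archi_boundP _)); rewrite ?invr_ge0 ?ltW// ltr_nat.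
  apply: filterS (lamQ N) => l [N' NN' [_ Q2]].
  apply: le_trans Q2 _; rewrite lee_fin; apply: le_trans Nle.
  by rewrite lef_pV2 ?posrE// ler_nat ltnS.
have -> : (fun l => P l [set w | false_selections (beta_coef (p l) (k l) (M l))
    (\col_j betahat l (lam l) j w) = 0%N]) = fun l => (1 - P l (bad2 l (lam l)))%E.
  apply/funext => l; rewrite -probability_setC//; congr (P l _).
  by apply/seteqP; split=> w /=; [move=> h1 h2; exact: h2|exact: contrapT].
rewrite -[X in _ --> X]sube0; apply: cvgeB => //; exact: cvg_cst.
Qed.
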